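(* For every integer $k\ge 2$, every planar graph $G$ of minimum degree at least $2$ and girth at least $15k-14$ satisfies $\operatorname{fdom}(G)\ge 3-1/k$.
   Context: For integers $0<q\le p$, a dominating $(p:q)$-colouring of a graph $G$ is a map $\phi\colon V(G)\to\binom{[p]}{q}$ with $\bigcup_{u\in N[v]}\phi(u)=[p]$ for every vertex $v$ ($N[v]$ the closed neighbourhood); the fractional domatic number $\operatorname{fdom}(G)$ is the maximum of $p/q$ over such colourings. *)

(* Defs.v *)
From mathcomp Require Import all_boot all_order all_algebra.
From mathcomp Require Import all_classical all_reals all_analysis.

Set Implicit Arguments.
Unset Strict Implicit.
Unset Printing Implicit Defensive.

Import Order.TTheory GRing.Theory Num.Theory.
Import numFieldNormedType.Exports.

Local Open Scope ring_scope.

(* A finite simple graph is a symmetric irreflexive relation e on a finType V. *)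

Section Graph.
Variables (R : realType) (V : finType) (e : rel V).

Definition degree (v : V) : nat := #|[pred u | e v u]|.

Definition closed_neighbourhood (v : V) : pred V := [pred u | (u == v) || e v u].

(* The size bound excludes x, y, x, which is an e-cycle for the library       *)
(* whenever x and y are adjacent.                                             *)
Definition graph_cycle (c : seq V) : Prop :=
  [/\ (3 <= size c)%N, uniq c & cycle e c].

(* The girth of a forest is infinite. *)
Definition girth_at_least (g : nat) : Prop :=
  forall c : seq V, graph_cycle c -> (g <= size c)%N.

Definition dominating_colouring (p q : nat) (phi : V -> {set 'I_p}) : Prop :=
  (forall v : V, #|phi v| = q) /\
  (forall v : V, \bigcup_(u in closed_neighbourhood v) phi u = [set: 'I_p])%SET.

Local Open Scope classical_set_scope.

Definition colouring_ratios : set R :=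
  [set x | exists p q : nat, [/\ (0 < q <= p)%N,
     exists phi : V -> {set 'I_p}, dominating_colouring q phi
   & x = p%:R / q%:R]].

(* The set of ratios is nonempty (p = q = 1) and, if V is nonempty, bounded   *)
(* by 1 plus the minimum degree, so the supremum is a genuine one.            *)
Definition fdom : R := sup (colouring_ratios).

Lemma fdom_max (x : R) :
  colouring_ratios x -> (forall y, colouring_ratios y -> y <= x) ->
  fdom = x.
Proof.
move=> Sx ubx; apply/eqP; rewrite eq_le; apply/andP; split.
  by apply: ge_sup => //; exists x.
by apply: ub_le_sup => //; exists x.
Qed.

(* A continuous injection of the compact [0, 1] into the plane is a           *)
(* homeomorphism onto its image.                                              *)
Definition is_arc (a b : R * R) (A : set (R * R)) : Prop :=
  exists f : R -> R * R,
    [/\ {within `[0, 1], continuous f},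
        {in `[0, 1] &, injective f},
        f 0 = a, f 1 = b & A = f @` `[0, 1] ].

(* arc X is the closed arc drawn for an edge with set of ends X; its values   *)
(* on sets that are not edges are irrelevant.  By the third clause, the       *)
(* common points allowed by the fourth one are common ends.                   *)
Definition plane_drawing (pos : V -> R * R) (arc : {set V} -> set (R * R)) :
    Prop :=
  [/\ injective pos,
      forall u v, e u v -> is_arc (pos u) (pos v) (arc [set u; v]%SET),
      forall u v w, e u v -> arc [set u; v]%SET (pos w) -> w = u \/ w = v
    & forall u v x y, e u v -> e x y -> [set u; v]%SET <> [set x; y]%SET ->
        arc [set u; v]%SET `&` arc [set x; y]%SET `<=` range pos].

Definition planar : Prop := exists pos arc, plane_drawing pos arc.

End Graph.

(* Main.v *)
(* The colouring is built by induction on a vertex set S.  A vertex of degree  *)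
(* at most 1 in S, or a thread of 3k - 3 vertices of degree 2, is removed and  *)
(* put back; on the thread, consecutive triples of k-sets must cover the       *)
(* 3k - 1 colours, and any two k-sets can be joined in that way.  If all       *)
(* degrees in S are at least 2, planarity gives a cycle with at most five      *)
(* vertices of degree 3 or more, and by the girth it contains such a thread    *)
(* or can be coloured all around at once.                                      *)
(* The short cycle comes from counting in a 2-basis of the cycle space, as in  *)
(* MacLane's criterion.  Instead of the Jordan curve theorem, the drawing is   *)
(* discretized to a minor model in a fine grid on a torus, where the boundaries *)
(* of the faces of the model span the cycle space by plain linear algebra mod 2. *)
From mathcomp Require Import all_boot all_order all_algebra.
From mathcomp Require Import zify.

Set Implicit Arguments.
Unset Strict Implicit.
Unset Printing Implicit Defensive.

(** A dominating [(3k - 1 : k)]-colouring has ratio [3 - 1/k], so it suffices to find one. Along a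
    path whose inner vertices have degree 2, domination says that any three consecutive [k]-sets
    cover the palette. Put one set [Y] at every third vertex: the two sets in between need only
    cover the rest, about [2k - 1] colours, and there one colour of a [k]-set can be exchanged in
    two steps. So [3k - 2] steps lead from any [k]-set to any other ([ends_sequence]), and a cycle
    of at least [6k - 2] vertices can be coloured all around by evenly spread intervals
    ([cyclic_sequence]).

    Hence, in a smallest vertex set without a partial colouring in the sense of [well_coloured], all
    inner degrees are at least 2 ([extend_isolated], [extend_pendant]), and there is neither a long
    thread between two distinct branch vertices (those of degree at least 3) nor a long cycle with
    at most one branch vertex ([extend_thread]). But a cycle with at most five branch vertices and
    at least [15k - 14 > 5(3k - 3)] vertices yields one or the other ([extend_cycle]).

    Such a cycle comes from an Euler type count ([exists_light_cycle]). A 2-basis has at least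
    [|E| - |S| + 1] nonzero members, which exceeds [B/6] for the sum [B] of the degrees of branch
    vertices. No edge is in more than two members, so some member has total degree below 12 at the
    branch vertices, and a cycle inside it passes at most five of them.

    The 2-basis comes from planarity: [planar_grid_model] turns the drawing into a minor model in a
    grid, which is placed on a torus. There every even chain that avoids one row and one column
    bounds ([torus_even_coboundary]), and [surface_two_basis] carries the boundaries of regions over
    to the graph. *)

(** * Walks between two colour sets *)

Section EndsWalk.
Variables (C : finType) (k : nat).
Implicit Types (A B W Y : {set C}) (x w : nat -> {set C}).

Lemma subset_between (A D : {set C}) m :
  A \subset D -> #|A| <= m <= #|D| ->
  exists B, [/\ A \subset B, B \subset D & #|B| = m].
Proof.
move=> sAD; elim: m => [|m IHm] /andP[leA leD].
  by exists A; split=> //; apply/eqP; rewrite -leqn0.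
have [leAm|ltmA] := leqP #|A| m; last first.
  by exists A; split=> //; apply/eqP; rewrite eqn_leq leA.
have [|B [sAB sBD cB]] := IHm; first by rewrite leAm ltnW.
have /subsetPn[y yD yB] : ~~ (D \subset B).
  by apply: contraL leD => /subset_leq_card; rewrite cB -leqNgt.
exists (y |: B); split; last by rewrite cardsU1 yB cB.
  by apply: subset_trans sAB (subsetUr _ _).
by rewrite subUset sub1set yD.
Qed.

(** One colour is exchanged in two steps: from [A] through [W :\: (A :\ a)], which has at most [k]
    elements, to [b |: A :\ a]. A colour of [A] outside [W] is the first to leave. *)
Lemma swap_walk W A B m :
  #|W| <= (2 * k).-1 -> #|A| = k -> #|B| = k -> B \subset W ->
  #|A :\: W| <= 1 -> #|A :\: B| <= m ->
  exists w, [/\ w 0 = A, w (2 * m) = B, forall i, #|w i| <= k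
    & forall i, W \subset w i :|: w i.+1].
Proof.
move=> cW; elim: m A => [|m IHm] A cA cB sBW cAW cAB; have [AB|nAB] := eqVneq A B.
- exists (fun i => if odd i then W :\: A else A); split=> // [i|i].
    by case: (odd i); rewrite ?cA // cardsD AB (setIidPr sBW) cB; lia.
  by rewrite /=; case: (odd i); apply/subsetP=> y yW; rewrite !inE yW;
    case: (y \in A).
- case/eqP: nAB; apply/eqP.
  by rewrite eqEcard cB cA leqnn andbT -setD_eq0 -cards_eq0 -leqn0.
- exists (fun i => if odd i then W :\: A else A); split=> // [|i|i].
  + by rewrite oddM.
  + by case: (odd i); rewrite ?cA // cardsD AB (setIidPr sBW) cB; lia.
  by rewrite /=; case: (odd i); apply/subsetP=> y yW; rewrite !inE yW;
    case: (y \in A).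
have AB_gt0 : 0 < #|A :\: B|.
  rewrite lt0n cards_eq0 setD_eq0; apply: contra nAB => sAB.
  by rewrite eqEcard sAB cA cB leqnn.
have [a aAB sAaW] : exists2 a, a \in A :\: B & A :\ a \subset W.
  have [AW0|] := eqVneq (A :\: W) set0.
    have [a aAB] := card_gt0P AB_gt0; exists a => //.
    by apply: subset_trans (subsetDl _ _) _; rewrite -setD_eq0 AW0.
  case/set0Pn=> a aAW; exists a.
    move: aAW; rewrite !inE => /andP[aW ->]; rewrite andbT.
    by apply: contra aW; apply: (subsetP sBW).
  apply/subsetP=> y; rewrite !inE => /andP[yNa yA]; apply: contraR yNa => yW.
  by move/card_le1_eqP: cAW => cAW; apply/eqP/cAW => //; rewrite inE yW.
move: (aAB); rewrite inE => /andP[aB aA].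
have [b bBA] : exists b, b \in B :\: A.
  apply/set0Pn; rewrite -cards_eq0; apply/eqP=> BA0.
  have := cardsID A B; have := cardsID B A; rewrite setIC; lia.
move: (bBA); rewrite inE => /andP[bA bB].
pose A1 := b |: A :\ a.
have cAa : #|A :\ a| = k.-1 by have := cardsD1 a A; rewrite aA cA; lia.
have k_gt0 : 0 < k by rewrite -cA; apply/card_gt0P; exists a.
have bW : b \in W by apply: (subsetP sBW).
have [|||w [w0 wm wk wW]] := IHm A1 _ cB sBW.
- by rewrite cardsU1 !inE (negbTE bA) andbF /= cAa; lia.
- suff ->: A1 :\: W = set0 by rewrite cards0.
  by apply/eqP; rewrite setD_eq0 subUset sub1set bW.
- have ->: A1 :\: B = (A :\: B) :\ a.
    apply/setP=> y; rewrite !inE; case: (eqVneq y b) => [->|_] /=.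
      by rewrite bB andbF.
    by rewrite andbCA.
  by have := cardsD1 a (A :\: B); rewrite aAB; lia.
exists (fun i => if i is j.+2 then w j
                 else if i is 1 then W :\: (A :\ a) else A).
have ->: 2 * m.+1 = (2 * m).+2 by lia.
split=> // [[|[|i]]|[|[|i]]] //=.
- by rewrite cA.
- by rewrite cardsD (setIidPr sAaW) cAa; lia.
- by apply/subsetP=> y yW; rewrite !inE yW; case: (y \in A); case: (y == a).
- rewrite w0; apply/subsetP=> y yW; rewrite !inE yW; case: (y \in A);
  by case: (y == a); rewrite ?orbT.
Qed.

Hypothesis cardC : #|C| = 3 * k - 1.

(* Every triple of consecutive sets will contain Y, so that the other two only *)
(* have to cover the complement W of Y.                                       *)
Lemma ends_walk A B L : #|A| = k -> #|B| = k -> (2 * k).-1 <= L ->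
  exists Y w, [/\ #|Y| <= k, w 0 = A, w L = B, forall i, #|w i| <= k
    & forall i, i < L -> [set: C] \subset Y :|: (w i :|: w i.+1)].
Proof.
move=> cA cB leL; have cU := cardsUI A B; have cUC := cardsC (A :|: B).
have cover (Y D : {set C}) : ~: Y \subset D -> [set: C] \subset Y :|: D.
  by move=> sYD; rewrite -(setUCr Y) setUS.
(* If [A] and [B] share a colour, a [k]-set [Y] fits outside both. If they are disjoint, only
   [k - 1] colours remain outside; these form [Y] when [L] is odd, and one colour of [A] joins them
   when [L] is even. *)
have [AB0|/set0Pn[z zAB]] := eqVneq (A :&: B) set0; last first.
  have /(subset_between (sub0set _))[Y [_ sY cY]] : #|set0 : {set C}| <= k <= #|~: (A :|: B)|.
    have : 0 < #|A :&: B| by apply/card_gt0P; exists z.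
    by rewrite cards0 /=; lia.
  have cYC := cardsC Y.
  have sAY : A \subset ~: Y by rewrite -setCS setCK (subset_trans sY) // setCS subsetUl.
  have sBY : B \subset ~: Y by rewrite -setCS setCK (subset_trans sY) // setCS subsetUr.
  move: (zAB); rewrite inE => /andP[zA zB].
  have AY0 : A :\: ~: Y = set0 by apply/eqP; rewrite setD_eq0.
  have [m [oL Lm]] : exists m, (L = 2 * m \/ L = (2 * m).+1) /\ m = L./2.
    by exists L./2; split=> //; have := odd_double_half L; lia.
  case: oL => oL.
    have [|||w [w0 wL wk wW]] := @swap_walk (~: Y) A B m _ cA cB sBY.
    - by lia.
    - by rewrite AY0 cards0.
    - by have := subset_leq_card (subsetDl A B); lia.
    by exists Y, w; split=> //; [rewrite cY|rewrite oL|move=> i _; apply: cover].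
  (* An odd walk ends with the step from [B'] to [B]; as [B'] shares [z] with [A], the [k - 1]
     exchanges left after rounding [L / 2] down are enough. *)
  pose B' := z |: (~: Y :\: B).
  have cB' : #|B'| = k.
    rewrite cardsU1 !inE zB /= cardsD (setIidPr sBY) cB.
    have : 0 < k by rewrite -cA; apply/card_gt0P; exists z.
    by lia.
  have [||||w [w0 wL wk wW]] := @swap_walk (~: Y) A B' m _ cA cB'.
  - by lia.
  - by rewrite subUset subsetDl andbT sub1set (subsetP sAY).
  - by rewrite AY0 cards0.
  - suff : #|A :\: B'| <= #|A :\ z| by have := cardsD1 z A; rewrite zA cA; lia.
    by apply: subset_leq_card; rewrite setDS // sub1set !inE eqxx.
  exists Y, (fun i => if i <= 2 * m then w i else B); split=> // [||i|i ltiL].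
  - by rewrite cY.
  - by rewrite oL ltnn.
  - by case: ifP; rewrite ?cB.
  - apply: cover; have ->: i <= 2 * m by lia.
    case: ltnP => // le; have ->: i = 2 * m by lia.
    by rewrite wL; apply/subsetP=> y; rewrite !inE => ->; rewrite andbT -orbA orNb orbT.
have cI0 : #|A :&: B| = 0 by rewrite AB0 cards0.
have [oL|oL] := boolP (odd L).
  exists (~: (A :|: B)), (fun i => if odd i then B else A); split=> //.
  - by lia.
  - by rewrite oL.
  - by move=> i; case: (odd i); rewrite ?cA ?cB.
  by move=> i _; apply: cover; rewrite setCK /=; case: (odd i); rewrite // setUC.
have [k0|k_gt0] := posnP k.
  have ABe: A = B.
    by move/eqP: cA; move/eqP: cB; rewrite k0 !cards_eq0 => /eqP-> /eqP->.
  exists set0, (fun=> A); split=> //; rewrite ?cards0 // => i.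
    by rewrite cA.
  move=> _; apply/subsetP=> y _; have : 0 < #|C| by apply/card_gt0P; exists y.
  by rewrite cardC k0.
have [a aA] : exists a, a \in A by apply/card_gt0P; rewrite cA.
have aB : a \notin B.
  apply/negP=> aB; have : 0 < #|A :&: B| by apply/card_gt0P; exists a; rewrite inE aA.
  by rewrite cI0.
pose Y := a |: ~: (A :|: B).
have cY : #|Y| = k by rewrite cardsU1 !inE aA /=; lia.
have cYC := cardsC Y.
have [m Lm] : exists m, L = 2 * m.
  by exists L./2; have := odd_double_half L; rewrite (negbTE oL); lia.
have [||||w [w0 wL wk wW]] := @swap_walk (~: Y) A B m _ cA cB.
- by lia.
- apply/subsetP=> y yB; rewrite !inE yB orbT /= orbF.
  by apply: contraNneq aB => <-.
- suff /subset_leq_card: A :\: ~: Y \subset [set a] by rewrite cards1.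
  apply/subsetP=> y; rewrite in_set1 in_setD in_setC negbK in_setU1 in_setC in_setU.
  by case: (y == a) => //=; case: (y \in A); rewrite ?andbF.
- by have := subset_leq_card (subsetDl A B); lia.
by exists Y, w; split=> //; [rewrite cY|rewrite Lm|move=> i _; apply: cover].
Qed.

End EndsWalk.

(** * Colour sequences on threads and around cycles *)

Section Sequences.
Variables (C : finType) (k : nat).
Implicit Types (A B : {set C}) (x : nat -> {set C}).
Hypothesis cardC : #|C| = 3 * k - 1.

(** Enlarging sets preserves covers, so the constructions below may use sets of at most [k]
    colours. *)
Lemma pad_sets : exists h : {set C} -> {set C},
  forall A, #|A| <= k -> A \subset h A /\ #|h A| = k.
Proof.
have /fin_all_exists[h hP] : forall A : {set C}, exists B : {set C},
    #|A| <= k -> A \subset B /\ #|B| = k; last by exists h.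
move=> A; have [leA|_] := leqP #|A| k; last by exists A.
have [||B [sAB _ cB]] := @subset_between _ A setT k; first exact: subsetT.
  by rewrite leA cardsT cardC; lia.
by exists B.
Qed.

Lemma pad_id (h : {set C} -> {set C}) A :
  (forall A, #|A| <= k -> A \subset h A /\ #|h A| = k) -> #|A| = k -> h A = A.
Proof.
move=> hP cA; have [|sAh ch] := hP A; first by rewrite cA.
by apply/esym/eqP; rewrite eqEcard sAh ch cA leqnn.
Qed.

(** With [Y] at every third index, [3k - 2] steps leave the [2k - 1] steps that [ends_walk] asks
    for. *)
Lemma ends_sequence A B n : #|A| = k -> #|B| = k -> 3 * k - 2 <= n ->
  exists x, [/\ x 0 = A, x n = B, forall i, #|x i| = k
    & forall i, i.+1 < n -> x i :|: x i.+1 :|: x i.+2 = [set: C]].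
Proof.
move=> cA cB len.
suff [x [x0 xn xk xC]] : exists x, [/\ x 0 = A, x n = B, forall i, #|x i| <= k
    & forall i, i.+1 < n -> [set: C] \subset x i :|: x i.+1 :|: x i.+2].
  have [h hP] := pad_sets; exists (h \o x); split=> [|||i lti] /=.
  - by rewrite x0 (pad_id hP).
  - by rewrite xn (pad_id hP).
  - by move=> i; have [] := hP _ (xk i).
  apply/eqP; rewrite eqEsubset subsetT (subset_trans (xC i lti)) //.
  have sx j : x j \subset h (x j) by case: (hP _ (xk j)).
  by rewrite !setUSS.
pose L := n - n.+1 %/ 3.
have [|Y [w [cY w0 wL wk wC]]] := ends_walk cardC (L := L) cA cB.
  by rewrite /L; lia.
have cov (u v t : {set C}) : [set: C] \subset Y :|: (u :|: v) ->
    t = Y :|: (u :|: v) -> [set: C] \subset t by move=> ? ->.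
(* The residue of the indices carrying [Y] avoids those of [0] and [n]; the quotient subtracted
   below counts the copies of [Y] up to index [i]. *)
pose r := if n %% 3 == 2 then 1 else 2.
exists (fun i => if i %% 3 == r then Y else w (i - (i + (3 - r)) %/ 3)); split.
- by rewrite mod0n sub0n w0 /r; case: (n %% 3 == 2).
- rewrite /r -wL /L; have [n3|n3] := boolP (n %% 3 == 2).
    by rewrite (eqP n3) /=; congr w; lia.
  by rewrite (negbTE n3); congr w; lia.
- by move=> i; case: ifP.
move=> i lti; rewrite /r; have [n3|n3] := boolP (n %% 3 == 2) => /=.
  have : [\/ i %% 3 = 0, i %% 3 = 1 | i %% 3 = 2].
    by have := ltn_pmod i (isT : 0 < 3); case: (i %% 3) => [|[|[|]]] // _;
      constructor.
  case=> i3.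
  - have [-> -> ->]: [/\ (i %% 3 == 1) = false, i.+1 %% 3 == 1 & (i.+2 %% 3 == 1) = false] by split; lia.
    apply: (cov _ _ _ (wC (i - (i + 2) %/ 3) _)); first by rewrite /L; lia.
    have ->: i.+2 - (i.+2 + (3 - 1)) %/ 3 = (i - (i + 2) %/ 3).+1 by lia.
    by rewrite setUA (setUC Y).
  - have [-> -> ->]: [/\ (i %% 3 == 1), (i.+1 %% 3 == 1) = false & (i.+2 %% 3 == 1) = false] by split; lia.
    apply: (cov _ _ _ (wC (i.+1 - (i.+1 + 2) %/ 3) _)); first by rewrite /L; lia.
    have ->: i.+2 - (i.+2 + (3 - 1)) %/ 3 = (i.+1 - (i.+1 + 2) %/ 3).+1 by lia.
    by rewrite setUA.
  have [-> -> ->]: [/\ (i %% 3 == 1) = false, (i.+1 %% 3 == 1) = false & (i.+2 %% 3 == 1)] by split; lia.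
  apply: (cov _ _ _ (wC (i - (i + 2) %/ 3) _)); first by rewrite /L; lia.
  have ->: i.+1 - (i.+1 + (3 - 1)) %/ 3 = (i - (i + 2) %/ 3).+1 by lia.
  by rewrite setUC.
have : [\/ i %% 3 = 0, i %% 3 = 1 | i %% 3 = 2].
  by have := ltn_pmod i (isT : 0 < 3); case: (i %% 3) => [|[|[|]]] // _;
    constructor.
case=> i3.
- have [-> -> ->]: [/\ (i %% 3 == 2) = false, (i.+1 %% 3 == 2) = false & (i.+2 %% 3 == 2)] by split; lia.
  apply: (cov _ _ _ (wC (i - (i + 1) %/ 3) _)); first by rewrite /L; lia.
  have ->: i.+1 - (i.+1 + (3 - 2)) %/ 3 = (i - (i + 1) %/ 3).+1 by lia.
  by rewrite setUC.
- have [-> -> ->]: [/\ (i %% 3 == 2) = false, (i.+1 %% 3 == 2) & (i.+2 %% 3 == 2) = false] by split; lia.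
  apply: (cov _ _ _ (wC (i - (i + 1) %/ 3) _)); first by rewrite /L; lia.
  have ->: i.+2 - (i.+2 + (3 - 2)) %/ 3 = (i - (i + 1) %/ 3).+1 by lia.
  by rewrite setUA (setUC Y).
have [-> -> ->]: [/\ (i %% 3 == 2), (i.+1 %% 3 == 2) = false & (i.+2 %% 3 == 2) = false] by split; lia.
apply: (cov _ _ _ (wC (i.+1 - (i.+1 + 1) %/ 3) _)); first by rewrite /L; lia.
have ->: i.+2 - (i.+2 + (3 - 2)) %/ 3 = (i.+1 - (i.+1 + 1) %/ 3).+1 by lia.
by rewrite setUA.
Qed.

(* The sets are cyclic intervals of length k, whose left ends are spread as     *)
(* evenly as possible around the cycle of colours.                            *)
Lemma cyclic_sequence A n : #|A| = k -> 6 * k - 2 <= n ->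
  exists x, [/\ x 0 = A, forall i, #|x i| = k, forall i, x (i + n) = x i
    & forall i, x i :|: x i.+1 :|: x i.+2 = [set: C]].
Proof.
move=> cA len; have [k0|k_gt0] := posnP k.
  exists (fun=> set0); split=> //; rewrite ?cards0 ?k0 //.
    by apply/esym/eqP; rewrite -cards_eq0 cA k0.
  by move=> i; rewrite !setU0; apply/setP=> c; have := cardC; rewrite k0 => /card0_eq/(_ c).
pose p := 3 * k - 1; have p_gt0 : 0 < p by rewrite /p; lia.
have n_gt0 : 0 < n by lia.
have ltkp : k <= p by rewrite /p; lia.
(* Ranking the colours of [A] first makes [A] the interval of ranks below [k]. *)
pose r c := index c (enum A ++ enum (~: A)).
have r_mem c : c \in enum A ++ enum (~: A).
  by rewrite mem_cat !mem_enum inE orbN.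
have ltr c : r c < p.
  rewrite /r /p -cardC -(cardsC A) !cardE -size_cat index_mem; exact: r_mem.
have r_inj : injective r.
  by move=> c d /(congr1 (nth c (enum A ++ enum (~: A)))); rewrite !nth_index.
have rA c : (r c < k) = (c \in A).
  rewrite /r index_cat mem_enum; case: ifP => cinA.
    by rewrite -cA cardE index_mem mem_enum.
  by apply/negbTE; rewrite -leqNgt -cA cardE leq_addr.
(* The left ends wind [M] times around the [p] colours in [n] steps. Rounding [M] down keeps a step
   at most [k], and [2p <= n] keeps two steps at least [2k - 1]. *)
pose M := (n * k) %/ p; pose s i := (i * (M * p)) %/ n.
have leM : M * p <= n * k by apply: leq_divM.
have ltM : n * k < M.+1 * p by rewrite ltn_ceil.
have s1 i : s i.+1 <= s i + k.
  by rewrite addnC /s -(divnMDl _ _ n_gt0) leq_div2r // mulSn leq_add2r (mulnC k).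
have s2 i : s i + (2 * k).-1 <= s i.+2.
  rewrite addnC /s -(divnMDl _ _ n_gt0) leq_div2r //.
  rewrite -[i.+2]add2n mulnDl leq_add2r.
  have : 2 * (n * k) < 2 * (M * p) + 2 * p by rewrite -mulnDr [_ + p]addnC -mulSn ltn_pmul2l.
  rewrite -subn1 mulnBl mul1n; have -> : 2 * k * n = 2 * (n * k) by rewrite -mulnA (mulnC k).
  by have : 2 * p <= n; [rewrite /p | ]; lia.
pose t j c := (r c + (p - s j %% p)) %% p.
have tE j c a d : d < p -> r c + a * p = s j + d -> t j c = d.
  move=> ltd E; rewrite -[RHS](modn_small ltd); apply/eqP.
  rewrite -(eqn_modDr (s j)) (addnC d) -E (addnC _ (a * p)) modnMDl.
  suff -> : r c + (p - s j %% p) + s j = (s j %/ p).+1 * p + r c by rewrite modnMDl.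
  have := divn_eq (s j) p; have := ltn_pmod (s j) p_gt0; rewrite mulSn.
  by move: (s j %/ p * p) (s j %% p) => u v; lia.
pose y j := [set c | t j c < k].
have cy j : #|y j| <= k.
  rewrite cardE -(size_map (t j)) -[leqRHS](size_iota 0); apply: uniq_leq_size.
    rewrite map_inj_uniq ?enum_uniq // => c d.
    move/eqP; rewrite eqn_modDr !modn_small // => /eqP; exact: r_inj.
  by move=> u /mapP[c]; rewrite mem_enum inE => tk ->; rewrite mem_iota.
have [h hP] := pad_sets; exists (h \o y); split=> [|i|i|i] /=.
- rewrite -[RHS](pad_id hP) //; congr h; apply/setP=> c; rewrite inE -rA.
  by rewrite /t /s mul0n div0n mod0n subn0 modnDr modn_small.
- by have [] := hP _ (cy i).
- congr h; apply/setP=> c; rewrite !inE /t.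
  by rewrite /s mulnDl [n * _]mulnC [i * _ + _]addnC divnMDl // modnMDl.
apply/eqP; rewrite eqEsubset subsetT /=.
apply/subsetP=> c _; rewrite !inE.
suff : [|| c \in y i, c \in y i.+1 | c \in y i.+2].
  by case/or3P=> /(subsetP (proj1 (hP _ (cy _)))) ->; rewrite ?orbT.
rewrite !inE; pose d := t i c.
have ltd : d < p by apply: ltn_pmod.
(* The rank of [c] is lifted to an integer in the window of length [p] from [s i], which the three
   intervals fill without gaps. *)
have [a E] : exists a, r c + a * p = s i + d.
  pose q := (r c + (p - s i %% p)) %/ p.
  have q2 : q < 2 by rewrite ltn_divLR //; have := ltr c; lia.
  exists (s i %/ p + 1 - q); rewrite mulnBl mulnDl mul1n.
  have := divn_eq (r c + (p - s i %% p)) p; rewrite -/q -/(t i c) -/d.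
  have := divn_eq (s i) p; have := ltn_pmod (s i) p_gt0.
  have : q * p <= 1 * p by rewrite leq_mul2r -ltnS q2 orbT.
  move: (q * p) (s i %/ p * p) (s i %% p) => u v w; lia.
have [ltdk|lekd] := ltnP d k; first by apply/or3P/Or31.
have := s1 i; have := s1 i.+1; have := s2 i => s2i s1i1 s1i.
have [lt1|le1] := ltnP (s i + d) (s i.+1 + k).
  apply/or3P/Or32; suff -> : t i.+1 c = s i + d - s i.+1 by lia.
  by apply: (@tE _ _ a); lia.
apply/or3P/Or33; suff -> : t i.+2 c = s i + d - s i.+2.
  by move: ltd; rewrite /p; lia.
by apply: (@tE _ _ a); lia.
Qed.

End Sequences.

(** * Pigeonhole for gaps in a list *)

Section Gaps.
Variables (T : eqType) (P : pred T).

(** Were all gaps shorter than [g], each entry in [P] together with the gap after it would take at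
    most [g] places. The entry [z] closes the last gap; taking [z = u] makes the list cyclic. *)
Lemma long_gap g (u z : T) (s : seq T) : P u -> P z ->
  count P (u :: s) * g < size (u :: s) ->
  exists o m, [/\ g <= m, o + m <= size s, P (nth u (rcons (u :: s) z) o),
    P (nth u (rcons (u :: s) z) (o + m).+1)
    & forall i, 0 < i <= m -> ~~ P (nth u (rcons (u :: s) z) (o + i))].
Proof.
have [N] := ubnP (size s); elim: N s u => // N IHN s u ltsN Pu Pz ltg.
have [|noP] := boolP (has P s); last first.
  exists 0, (size s); split=> //=; try by rewrite ?nth_rcons ?ltnn ?eqxx.
  - by move: ltg; rewrite /= Pu; move: noP; rewrite has_count; lia.
  case=> // i /andP[_ lti]; rewrite add0n /= nth_rcons lti.
  by apply: contra noP => Pi; apply/hasP; exists (nth u s i) => //; apply: mem_nth.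
move=> hs; case: (split_find hs) ltsN ltg => v s1 s2 Pv noP1 ltsN ltg {hs}.
rewrite cat_rcons in ltsN ltg *.
have -> : rcons (u :: s1 ++ v :: s2) z = (u :: s1) ++ rcons (v :: s2) z.
  by rewrite /= rcons_cat.
have [leg|ltg1] := leqP g (size s1).
  exists 0, (size s1); split=> //.
  - by rewrite size_cat /=; lia.
  - by rewrite add0n nth_cat ltnn subnn.
  case=> // i /andP[_ lti]; rewrite add0n nth_cat /= ltnS lti.
  by apply: contra noP1 => Pi; apply/hasP; exists (nth u s1 i) => //; apply: mem_nth.
have cs1 : count P s1 = 0 by move: noP1; rewrite has_count; lia.
have [||o [m [gm oms Po Pom Pi]]] := IHN s2 v _ Pv Pz.
- by move: ltsN; rewrite size_cat /=; lia.
- move: ltg; rewrite /= count_cat size_cat Pu cs1 /= Pv.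
  by rewrite !add0n !add1n !mulSn; lia.
have shift j : j <= size s2 + 1 ->
    nth u ((u :: s1) ++ rcons (v :: s2) z) (size (u :: s1) + j)
    = nth v (rcons (v :: s2) z) j.
  move=> lej; rewrite nth_cat ltnNge leq_addr /= addKn.
  by apply: set_nth_default; rewrite /= size_rcons; lia.
exists (size (u :: s1) + o), m; split=> //.
- by rewrite size_cat /=; lia.
- by rewrite shift //; lia.
- by rewrite -addnS -addnA shift; [rewrite addnS | lia].
by move=> i im; rewrite -addnA shift; [apply: Pi | lia].
Qed.

End Gaps.

(** * Partial colourings and their extension *)

Section WellColoured.
Variables (V C : finType) (e : rel V) (k : nat).
Hypotheses (e_sym : symmetric e) (e_irr : irreflexive e).
Hypothesis cardC : #|C| = 3 * k - 1.
Implicit Types (S : {set V}) (phi : V -> {set C}).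

Definition nbrs S v := [set u in S | e v u].

Definition seen phi S v := \bigcup_(u in v |: nbrs S v) phi u.

(* Three k-sets cover the 3k - 1 colours with one repetition; the condition   *)
(* is full domination where the degree in S is at least 2, and at vertices    *)
(* of smaller degree it keeps that extendable.                                *)
Definition well_coloured S phi :=
  (forall v, #|phi v| = k) /\
  forall v, v \in S -> minn 3 #|nbrs S v|.+1 * k - 1 <= #|seen phi S v|.

Lemma sub_seen phi S v u : u \in v |: nbrs S v -> phi u \subset seen phi S v.
Proof. by move=> uN; apply: (bigcup_max u). Qed.

Lemma seen_full phi S v : seen phi S v = [set: C] ->
  minn 3 #|nbrs S v|.+1 * k - 1 <= #|seen phi S v|.
Proof.
by move=> ->; rewrite cardsT cardC leq_sub2r // leq_mul2r geq_minl orbT.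
Qed.

Lemma well_coloured_full phi S v : well_coloured S phi -> v \in S ->
  2 <= #|nbrs S v| -> seen phi S v = [set: C].
Proof.
case=> _ wS vS d2; apply/eqP; rewrite eqEcard subsetT cardsT cardC.
by apply: leq_trans (wS v vS); rewrite (minn_idPl _).
Qed.

Lemma seen_ext phi phi' S S' v : {in S', phi' =1 phi} -> v \in S' ->
  S' \subset S -> seen phi S' v \subset seen phi' S v.
Proof.
move=> phiE vS' sS'S; apply/bigcupsP=> u uN.
have uS' : u \in S' by move: uN; rewrite !inE => /predU1P[->|/andP[]].
rewrite -phiE //; apply: sub_seen; move: uN; rewrite !inE.
by case/predU1P=> [->|/andP[_ ->]]; rewrite ?eqxx // (subsetP sS'S) ?orbT.
Qed.

(** Only the new vertices and those that gain a neighbour need checking. *)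
Lemma well_coloured_ext S S' phi phi' : S' \subset S ->
  {in S', phi' =1 phi} -> (forall v, #|phi' v| = k) -> well_coloured S' phi ->
  (forall v, v \in S -> v \in S' /\ nbrs S v \subset S' \/
     minn 3 #|nbrs S v|.+1 * k - 1 <= #|seen phi' S v|) ->
  well_coloured S phi'.
Proof.
move=> sS'S phiE phik [_ wS'] bnd; split=> // v vS.
case: (bnd v vS) => // -[vS' sN].
have NE : nbrs S v = nbrs S' v.
  apply/setP=> u; apply/idP/idP=> [uN|].
    by move: (uN); rewrite !inE => /andP[_ ->]; rewrite (subsetP sN).
  by rewrite !inE; case/andP=> /(subsetP sS'S) -> ->.
rewrite NE; apply: leq_trans (wS' v vS') _.
by apply: subset_leq_card; apply: seen_ext.
Qed.

Lemma extend_isolated S v phi : v \in S -> #|nbrs S v| = 0 ->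
  well_coloured (S :\ v) phi -> well_coloured S phi.
Proof.
move=> vS d0 wc; have phik := wc.1.
apply: (well_coloured_ext (subD1set S v) _ phik wc) => // u uS.
have [->|uv] := eqVneq u v.
  right; rewrite d0 -(phik v).
  apply: leq_trans (subset_leq_card (sub_seen phi (setU11 v _))).
  by rewrite phik; have := geq_minr 3 1; rewrite /minn /=; lia.
left; split; first by rewrite !inE uv.
apply/subsetP=> z; rewrite !inE => /andP[zS uz]; rewrite zS andbT.
apply/eqP=> zv; suff : 0 < #|nbrs S v| by rewrite d0.
by apply/card_gt0P; exists u; rewrite inE uS e_sym -zv.
Qed.

(** The new set must avoid [phi u], for the bound at [v], and supply what [u] misses. If [u] has
    another neighbour, it already sees [2k - 1] colours and misses at most [k]; otherwise any
    [k]-set disjoint from [phi u] will do. *)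
Lemma extend_pendant S v u phi : v \in S -> nbrs S v = [set u] ->
  well_coloured (S :\ v) phi -> exists phi', well_coloured S phi'.
Proof.
move=> vS Nv wc; have phik := wc.1.
have : u \in nbrs S v by rewrite Nv inE.
rewrite inE => /andP[uS evu].
have uv : u != v by apply: contraTneq evu => ->; rewrite e_irr.
have uS' : u \in S :\ v by rewrite !inE uv.
pose U := seen phi (S :\ v) u.
have sphiU : phi u \subset U by apply: sub_seen; rewrite setU11.
have cU := cardsC U; have cu := cardsC (phi u); have wu := wc.2 u uS'.
rewrite -/U in wu.
have [A [sUA sAu cA]] : exists A : {set C}, [/\ A \subset ~: phi u, #|A| = k &
    minn 3 #|nbrs (S :\ v) u|.+2 * k - 1 <= #|U :|: A|].
  have [N0|N_gt0] := posnP #|nbrs (S :\ v) u|.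
    have [|A [_ sA cA]] := @subset_between _ set0 (~: phi u) k (sub0set _).
      by move: cu; rewrite cards0 phik cardC; lia.
    exists A; split=> //; rewrite N0.
    have := subset_leq_card (setSU A sphiU); rewrite cardsU phik cA.
    have -> : phi u :&: A = set0.
      by apply/eqP; rewrite setI_eq0 disjoints_subset -setCS setCK.
    by rewrite cards0 /minn /=; lia.
  have cU2 : 2 * k - 1 <= #|U|.
    apply: leq_trans wu; rewrite leq_sub2r // leq_mul2r; apply/orP; right.
    by rewrite leq_min.
  have [||A [sA1 sA2 cA]] := @subset_between _ (~: U) (~: phi u) k.
  - by rewrite setCS.
  - by move: cu cU; rewrite phik cardC; lia.
  exists A; split=> //.
  suff -> : U :|: A = [set: C].
    by rewrite cardsT cardC leq_sub2r // leq_mul2r geq_minl orbT.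
  by apply/eqP; rewrite eqEsubset subsetT -(setUCr U) setUS.
pose phi' z := if z == v then A else phi z.
have phiE : {in S :\ v, phi' =1 phi}.
  by move=> z; rewrite !inE /phi' => /andP[/negbTE->].
exists phi'; apply: (well_coloured_ext (subD1set S v) phiE _ wc) => [z|z zS].
  by rewrite /phi'; case: ifP.
have [->|zv] := eqVneq z v.
  right; rewrite Nv cards1 /=.
  have sA : A \subset seen phi' S v.
    have -> : A = phi' v by rewrite /phi' eqxx.
    by apply: sub_seen; rewrite setU11.
  have su : phi u \subset seen phi' S v.
    rewrite -(phiE u uS'); apply: sub_seen; rewrite Nv; exact: setU1r (set11 u).
  have : #|phi u :|: A| <= #|seen phi' S v| by rewrite subset_leq_card // subUset su.
  rewrite cardsU phik sAu; have -> : phi u :&: A = set0.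
    by apply/eqP; rewrite setI_eq0 disjoints_subset -setCS setCK.
  by rewrite cards0 /minn /=; lia.
have [->|zu] := eqVneq z u.
  right; have -> : #|nbrs S u| = #|nbrs (S :\ v) u|.+1.
    rewrite (cardsD1 v) inE vS e_sym evu add1n; congr _.+1; apply: eq_card => t.
    by rewrite !inE andbA.
  apply: leq_trans cA _; apply: subset_leq_card; rewrite subUset.
  rewrite seen_ext ?subD1set //=.
  have -> : A = phi' v by rewrite /phi' eqxx.
  by apply: sub_seen; rewrite !inE vS e_sym evu orbT.
left; split; first by rewrite !inE zv.
apply/subsetP=> t; rewrite !inE => /andP[tS ezt]; rewrite tS andbT.
apply: contraNneq zu => tv.
have : z \in nbrs S v by rewrite inE zS e_sym -tv.
by rewrite Nv inE.
Qed.

(** An end of an open thread loses just one neighbour, so it keeps two in [S'] and already sees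
    every colour. If the thread closes up, its common end is served by the triple around it. *)
Lemma extend_thread S (y : nat -> V) n (x : nat -> {set C}) phi :
  let S' := S :\: [set y i | i : 'I_n & 0 < i] in
  2 < n ->
  (forall i, i <= n -> y i \in S) ->
  (forall i, i < n -> e (y i) (y i.+1)) ->
  (forall i, 0 < i < n -> #|nbrs S (y i)| = 2) ->
  (forall i j, i < j <= n -> y i = y j -> i = 0 /\ j = n) ->
  well_coloured S' phi ->
  x 0 = phi (y 0) -> x n = phi (y n) -> (forall i, #|x i| = k) ->
  (forall i, i.+1 < n -> x i :|: x i.+1 :|: x i.+2 = [set: C]) ->
  (y 0 = y n -> x n.-1 :|: x n :|: x 1 = [set: C]) ->
  (y 0 <> y n -> 2 < #|nbrs S (y 0)| /\ 2 < #|nbrs S (y n)|) ->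
  exists phi', well_coloured S phi'.
Proof.
move=> S' n2 yS ye yd yinj wc x0 xn xk xC close branch.
have phik := wc.1.
have sS' : S' \subset S by apply: subsetDl.
have in_end i : i <= n -> (y i \in S') = ~~ (0 < i < n).
  move=> lein; rewrite inE yS // andbT; congr (~~ _); apply/imsetP/idP.
    case=> j; rewrite inE => j0 E; have := ltn_ord j => ltj.
    have [lt|gt|eq] := ltngtP i j.
    - by have [|i0 jn] := yinj i j _ E; lia.
    - by have [|i0 jn] := yinj j i _ (esym E); lia.
    by lia.
  by case/andP=> i0 ltin; exists (Ordinal ltin); rewrite ?inE.
pose phi' z := if [pick i : 'I_n | (0 < i) && (y i == z)] is Some i then x i else phi z.
have phiy i : i <= n -> phi' (y i) = x i.
  move=> lein; rewrite /phi'; case: pickP => [j /andP[j0 /eqP E]|no].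
    have := ltn_ord j => ltj; congr x.
    have [lt|gt|//] := ltngtP j i.
    - by have [|i0 jn] := yinj j i _ E; lia.
    by have [|i0 jn] := yinj i j _ (esym E); lia.
  have : ~~ (0 < i < n).
    by apply/negP=> /andP[i0 ltin]; move: (no (Ordinal ltin)); rewrite /= i0 eqxx.
  move=> hi; have [->|i0] := posnP i; first by rewrite x0.
  have -> : i = n by lia.
  by rewrite xn.
have phiE : {in S', phi' =1 phi}.
  move=> z; rewrite /phi' inE => /andP[zy _]; case: pickP => // i /andP[i0 /eqP E].
  by case/imsetP: zy; exists i; rewrite ?inE.
have Ny i : 0 < i < n -> nbrs S (y i) = [set y i.-1; y i.+1].
  move=> lti; apply/esym/eqP; rewrite eqEcard yd // cards2; apply/andP; split.
    apply/subsetP=> z; rewrite !inE => /orP[]/eqP->; rewrite yS; try lia.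
      by rewrite e_sym; have := ye i.-1; rewrite prednK; [apply|]; lia.
    by apply: ye; lia.
  by have [E|//] := eqVneq (y i.-1) (y i.+1); have := yinj _ _ _ E; lia.
have full3 i : 0 < i <= n -> (i < n -> seen phi' S (y i) = [set: C]) /\
  (y 0 = y n -> i = n -> seen phi' S (y i) = [set: C]).
  move=> lti; split=> [ltin|E0 En].
    apply/eqP; rewrite eqEsubset subsetT /= -(xC i.-1); last lia.
    rewrite prednK; last lia.
    rewrite !subUset -!phiy; try lia.
    by rewrite !sub_seen // Ny ?inE ?eqxx ?orbT //; lia.
  apply/eqP; rewrite eqEsubset subsetT /= -(close E0) En !subUset -!phiy; try lia.
  rewrite !sub_seen // !inE ?eqxx //.
    by rewrite -E0 yS ?ye ?orbT //; lia.
  have := ye n.-1; rewrite prednK; last lia.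
  by rewrite e_sym yS => [->|]; rewrite ?orbT //; lia.
have adj v i : v \in S' -> 0 < i < n -> e v (y i) ->
    (i = 1 /\ v = y 0) \/ (i = n.-1 /\ v = y n).
  move=> vS' lti evi; have : v \in nbrs S (y i) by rewrite inE e_sym evi (subsetP sS').
  rewrite Ny // !inE => /orP[]/eqP E; move: vS'; rewrite E in_end; try lia.
    by move=> hi; left; have i1 : i = 1; [lia | subst i].
  by move=> hi; right; have i1 : i.+1 = n; [lia | subst n].
have end_full v i : v \in S' -> 2 < #|nbrs S v| ->
    (forall j, 0 < j < n -> e v (y j) -> j = i) -> seen phi' S v = [set: C].
  move=> vS' d3 only; apply/eqP; rewrite eqEsubset subsetT /=.
  rewrite -(well_coloured_full wc vS'); first exact: seen_ext.
  have : nbrs S v \subset y i |: nbrs S' v.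
    apply/subsetP=> z zN; have [zS'|zS'] := boolP (z \in S').
      by move: zN; rewrite !inE => /andP[_ ->]; move: zS'; rewrite inE => ->; rewrite orbT.
    move: zN zS'; rewrite !inE => /andP[zS evz]; rewrite zS andbT negbK.
    case/imsetP=> j; rewrite inE => j0 E; rewrite E in evz *.
    by rewrite (only j) ?eqxx // j0 ltn_ord.
  move=> /subset_leq_card; rewrite cardsU1; case: (_ \in _) => /=; lia.
exists phi'; apply: (well_coloured_ext sS' phiE _ wc) => [z|z zS].
  by rewrite /phi'; case: pickP.
have [zS'|] := boolP (z \in S'); last first.
  rewrite inE zS andbT negbK => /imsetP[i]; rewrite inE => i0 ->.
  right; apply: seen_full; have [|f _] := full3 i; first by rewrite i0 ltnW.
  exact: f.
have [->|z0] := eqVneq z (y 0).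
  right; apply: seen_full; have [E0|/eqP nE] := eqVneq (y 0) (y n).
    by rewrite E0; have [|_ f] := full3 n; [lia | apply: f].
  apply: (end_full _ 1) => [||j ltj e0j]; first by rewrite in_end.
    by case: (branch nE).
  by have [|[]|[_ E]] := adj (y 0) j _ ltj e0j; rewrite ?in_end.
have [->|zn] := eqVneq z (y n).
  right; apply: seen_full; have [E0|/eqP nE] := eqVneq (y 0) (y n).
    by have [|_ f] := full3 n; [lia | apply: f].
  apply: (end_full _ n.-1) => [||j ltj e0j]; first by rewrite in_end ?ltnn ?andbF.
    by case: (branch nE).
  have [|[_ E]|[]] // := adj (y n) j _ ltj e0j; rewrite ?in_end ?ltnn ?andbF //.
  by case: nE.
left; split=> //; apply/subsetP=> t; rewrite inE => /andP[tS ezt].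
rewrite inE tS andbT; apply/imsetP=> -[i]; rewrite inE => i0 E.
rewrite E in ezt; have [|[_ E']|[_ E']] := adj z i zS' _ ezt; first by rewrite i0 ltn_ord.
  by case/eqP: z0.
by case/eqP: zn.
Qed.

End WellColoured.

(** * Colouring along a cycle with few branch vertices *)

Section Sparse.
Variables (V C : finType) (e : rel V) (k : nat).
Hypotheses (e_sym : symmetric e) (e_irr : irreflexive e).
Hypothesis cardC : #|C| = 3 * k - 1.
Hypothesis k_gt1 : 1 < k.

Definition branch (S : {set V}) : pred V := [pred v | 2 < #|nbrs e S v|].

Lemma extend_cycle (S : {set V}) (c : seq V) :
  (forall v, v \in S -> 2 <= #|nbrs e S v|) ->
  {subset c <= S} -> uniq c -> cycle e c -> count (branch S) c <= 5 ->
  15 * k - 14 <= size c ->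
  (forall S' : {set V}, S' \proper S -> exists phi : V -> {set C}, well_coloured e k S' phi) ->
  exists phi : V -> {set C}, well_coloured e k S phi.
Proof.
move=> d2 cS uc ec b5 sc IH.
(* The cycle is rotated to start at a branch vertex, if it has one. *)
wlog [u [s [cE bu]]] : c cS uc ec b5 sc / exists u s, c = u :: s /\ (has (branch S) c -> branch S u).
  have [/hasP[u cu bu]|nb] := boolP (has (branch S) c); last first.
    move=> wl; apply: (wl c) => //.
    by case: (c) sc nb => [|u s] /=; [lia | exists u, s; split=> // /idPn].
  move=> wl; have [i s cE] := rot_to cu; apply: (wl (rot i c)).
  - by move=> v; rewrite mem_rot; apply: cS.
  - by rewrite rot_uniq.
  - by rewrite rot_cycle.
  - by have /permP -> : perm_eq (rot i c) c by rewrite perm_rot.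
  - by rewrite size_rot.
  by rewrite cE; exists u, s.
pose L := rcons (u :: s) u; pose z i := nth u L i.
rewrite cE in cS uc ec b5 sc bu.
have zS i : i <= size (u :: s) -> z i \in S.
  move=> lei; apply: cS; have : z i \in L by apply: mem_nth; rewrite size_rcons ltnS.
  by rewrite mem_rcons in_cons => /predU1P[->|//]; rewrite mem_head.
have ze i : i < size (u :: s) -> e (z i) (z i.+1).
  by move: ec => /= /(pathP u) ep lti; have := ep i; rewrite size_rcons; apply.
have zinj i j : i < j <= size (u :: s) -> z i = z j -> i = 0 /\ j = size (u :: s).
  case/andP=> ltij lej; have lti : i < size (u :: s) by apply: leq_trans lej.
  rewrite /z /L (nth_rcons _ _ _ i) lti (nth_rcons _ _ _ j).
  case: (ltngtP j (size (u :: s))) lej => [ltj _|//|-> _].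
    by move/eqP; rewrite nth_uniq // => /eqP eqij; move: ltij; rewrite eqij ltnn.
  move=> E; have : nth u (u :: s) i == nth u (u :: s) 0 by rewrite E.
  by rewrite nth_uniq // => /eqP.
have zd i : i <= size (u :: s) -> ~~ branch S (z i) -> #|nbrs e S (z i)| = 2.
  by move=> lei; rewrite /= -leqNgt => le2; apply/eqP; rewrite eqn_leq le2 d2 ?zS.
pose S' o n := S :\: [set z (o + i) | i : 'I_n & 0 < i].
have propS' o n : 1 < n -> o + n <= size (u :: s) -> S' o n \proper S.
  move=> n1 on; apply/properP; split; first exact: subsetDl.
  exists (z (o + 1)); first by apply: zS; lia.
  by rewrite inE negb_and negbK; apply/orP; left; apply/imsetP; exists (Ordinal n1); rewrite ?inE.
have bz0 i : i = 0 \/ i = size (u :: s) -> z i = u.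
  by case=> ->; rewrite /z /L ?nth_rcons ?ltnn ?eqxx.
have zc i : i < size (u :: s) -> z i \in u :: s.
  by move=> lti; rewrite /z /L nth_rcons lti mem_nth.
have countE : count (branch S) (u :: s) = branch S u + count (branch S) s by [].
(* With at most one branch vertex, all of the cycle but [u] is a closed thread; its length suffices
   since [6k - 2 <= 15k - 14] for [k >= 2]. *)
have [le1|lt1] := leqP (count (branch S) (u :: s)) 1.
  have nbr i : 0 < i < size (u :: s) -> ~~ branch S (z i).
    move=> /andP[i0 lti]; apply/negP=> bi.
    have bu' : branch S u by apply: bu; apply/hasP; exists (z i) => //; apply: zc.
    move: le1; rewrite countE bu' add1n ltnS leqNgt -has_count => /hasP[].
    exists (z i) => //; rewrite /z /L nth_rcons lti.
    by case: i i0 lti {bi} => // i _ lti; rewrite /= mem_nth.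
  have [|phi wphi] := IH (S' 0 (size (u :: s))); first by apply: propS'; lia.
  have [|x [x0 xk xp xC]] := cyclic_sequence cardC (n := size (u :: s)) (wphi.1 u).
    by lia.
  have xn : x (size (u :: s)) = x 0 by rewrite -[X in x X]add0n xp.
  apply: (extend_thread e_sym cardC (y := z) (n := size (u :: s)) (x := x) (phi := phi)) => //.
  - by lia.
  - by move=> i lti; apply: zd; [lia | apply: nbr].
  - by rewrite xn x0 (bz0 (size (u :: s))) //; right.
  - move=> _; rewrite -(xp 1) add1n; have := xC (size (u :: s)).-1.
    by rewrite prednK.
  by case; rewrite (bz0 0) ?(bz0 (size (u :: s))) //; [right | left].
have [|||o [m [gm oms bo bom bi]]] := @long_gap _ (branch S) (3 * k - 3) u u s _ _.
- by apply: bu; rewrite has_count; lia.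
- by apply: bu; rewrite has_count; lia.
(* This is where the constant of the girth bound comes from. *)
- have : 5 * (3 * k - 3) < size (u :: s) by lia.
  by apply: leq_ltn_trans; rewrite leq_mul2r b5 orbT.
have [|phi wphi] := IH (S' o m.+1).
  by apply: propS'; [lia | rewrite addnS ltnS].
have [|x [x0 xn xk xC]] := ends_sequence cardC (n := m.+1) (wphi.1 (z o)) (wphi.1 (z (o + m).+1)).
  by lia.
(* Equal ends would make the gap the whole rest of the cycle, which contains a second branch
   vertex. *)
have bzo : z o <> z (o + m).+1.
  move=> E; have [|o0 om] := zinj _ _ _ E; first by rewrite ltnS leq_addr.
  have bu' : branch S u by apply: bu; rewrite has_count ltnW.
  move: lt1; rewrite ltnNge countE bu' add1n ltnS => /negP[].
  rewrite leqNgt -has_count; apply/hasP=> -[v vs bv].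
  have := bi (index v s).+1; rewrite o0 add0n /= nth_rcons index_mem vs nth_index //.
  rewrite bv; suff -> : index v s < m by move/(_ isT).
  by case: om; rewrite o0 add0n => ->; rewrite index_mem.
apply: (extend_thread e_sym cardC (y := fun i => z (o + i)) (n := m.+1) (x := x) (phi := phi)) => //.
- by lia.
- by move=> i lei; apply: zS; move: oms lei => /=; lia.
- by move=> i lti; rewrite addnS; apply: ze; move: oms lti => /=; lia.
- by move=> i lti; apply: zd; [move: oms lti => /=; lia | apply: bi].
- move=> i j ltij E; have [|o0 oj] := zinj _ _ _ E; first by move: oms ltij => /=; lia.
  by move: oj oms => /=; lia.
- by rewrite addn0.
- by rewrite addnS.
- by rewrite addn0 addnS => /bzo.
by move=> _; rewrite addn0 addnS.
Qed.

Lemma exists_well_coloured :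
  (forall S : {set V}, S != set0 -> (forall v, v \in S -> 2 <= #|nbrs e S v|) ->
    exists c, [/\ {subset c <= S}, uniq c, cycle e c,
      count (branch S) c <= 5 & 15 * k - 14 <= size c]) ->
  exists phi : V -> {set C}, well_coloured e k [set: V] phi.
Proof.
move=> sparse; have [N] := ubnP #|[set: V]|; move: [set: V] => S.
elim: N S => // N IHN S; rewrite ltnS => leSN.
have IH (S' : {set V}) : S' \proper S -> exists phi : V -> {set C}, well_coloured e k S' phi.
  by move=> /proper_card ltS'S; apply: IHN; apply: leq_trans leSN.
have [->|S0] := eqVneq S set0.
  have [|A [_ _ cA]] := @subset_between _ set0 [set: C] k (sub0set _).
    by rewrite cards0 cardsT cardC; lia.
  by exists (fun=> A); split=> // v; rewrite inE.
have [/forall_inP d2|] := boolP [forall v in S, 2 <= #|nbrs e S v|].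
  by have [c [cS uc ec b5 sc]] := sparse S S0 d2; apply: (extend_cycle d2 cS).
rewrite negb_forall_in => /exists_inP[v vS]; rewrite -ltnNge ltnS => d1.
have [phi wphi] := IH _ (properD1 vS).
have [d0|] := posnP #|nbrs e S v|; first by exists phi; apply: extend_isolated wphi.
move=> d_gt0; have /cards1P[u Nv] : #|nbrs e S v| == 1 by rewrite eqn_leq d1.
by apply: extend_pendant vS Nv wphi.
Qed.

End Sparse.

(** * The cycle space mod 2 and the degree count *)

Section Counting.
Import GRing.Theory.
Local Open Scope ring_scope.

Section Boundary.
Variables (X T : finType) (a b : X -> T).
Implicit Types (z : X -> bool) (chi : T -> bool).

(* The chain z has coefficients in bool, as the field with two elements; the  *)
(* value is the pairing of its boundary with the cochain chi.                 *)
Definition boundary z chi : bool := \sum_x z x * (chi (a x) + chi (b x)).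

Definition even z := forall chi, boundary z chi = 0.

Lemma boundaryD z1 z2 chi :
  boundary (fun x => z1 x + z2 x) chi = boundary z1 chi + boundary z2 chi.
Proof. by rewrite -big_split; apply: eq_bigr => x _; rewrite mulrDl. Qed.

Lemma boundary_sum (I : finType) (z : I -> X -> bool) chi :
  boundary (fun x => \sum_i z i x) chi = \sum_i boundary (z i) chi.
Proof. by rewrite exchange_big; apply: eq_bigr => x _; rewrite mulr_suml. Qed.

Lemma boundaryMl c z chi : boundary (fun x => c * z x) chi = c * boundary z chi.
Proof. by rewrite mulr_sumr; apply: eq_bigr => x _; rewrite mulrA. Qed.

Lemma boundary_chi z chi :
  boundary z chi = \sum_t chi t * boundary z (fun t' => t' == t).
Proof.
have chiE t' : chi t' = \sum_t chi t * (t' == t : bool).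
  rewrite (bigD1 t') //= eqxx big1 ?addr0 ?mulr1 // => t nt.
  by rewrite eq_sym (negbTE nt) mulr0.
rewrite /boundary; under [RHS]eq_bigr do rewrite mulr_sumr.
rewrite exchange_big; apply: eq_bigr => x _.
rewrite chiE [chi (b x)]chiE -big_split mulr_sumr.
by apply: eq_bigr => t _; rewrite /= -mulrDr mulrCA.
Qed.

Lemma boundary_eq z z' chi : z =1 z' -> boundary z chi = boundary z' chi.
Proof. by move=> zz'; apply: eq_bigr => x _; rewrite zz'. Qed.

End Boundary.

Variables (V E Q : finType) (src tgt : E -> V).

Definition edge_degree (s : E -> bool) (v : V) : nat :=
  (\sum_Y s Y * ((src Y == v) + (tgt Y == v)))%N.

(* MacLane's planarity criterion: a basis of the cycle space that uses every  *)
(* edge at most twice.                                                        *)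
Definition two_basis (b : Q -> E -> bool) :=
  [/\ forall q, even src tgt (b q), forall Y, (#|[set q | b q Y]| <= 2)%N
    & forall s, even src tgt s -> exists c : Q -> bool, forall Y, s Y = \sum_q c q * b q Y].

Variables (S : {set V}) (v0 : V).
Hypotheses (v0S : v0 \in S) (srcS : forall Y, src Y \in S) (tgtS : forall Y, tgt Y \in S).

Let odd_at (s : {ffun E -> bool}) :=
  [set v in S :\ v0 | boundary src tgt s (fun t => t == v)].

(** Handshake lemma: the degree at [v0] is even once all the others are. *)
Lemma odd_at_even (s : {ffun E -> bool}) : odd_at s = set0 -> even src tgt s.
Proof.
move=> s0.
have out v : v \notin S -> boundary src tgt s (fun t => t == v) = 0.
  move=> vS; apply: big1 => Y _.
  have neq t : t \in S -> (t == v) = false by move=> tS; apply: contraNF vS => /eqP <-.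
  by rewrite !neq ?addr0 ?mulr0.
have ev v : v != v0 -> boundary src tgt s (fun t => t == v) = 0.
  move=> vv0; have [vS|] := boolP (v \in S); last exact: out.
  apply/negbTE/negP=> bv; suff : v \in set0 by rewrite inE.
  by rewrite -s0 !inE vv0 vS.
have ev0 : boundary src tgt s (fun t => t == v0) = 0.
  have := boundary_chi src tgt s (fun=> 1); rewrite (bigD1 v0) //= mul1r big1.
    by rewrite addr0 => <-; apply: big1 => Y _; rewrite /= mulr0.
  by move=> v vv0; rewrite ev ?mulr0.
move=> chi; rewrite boundary_chi big1 // => v _.
by have [->|vv0] := eqVneq v v0; rewrite ?ev0 ?ev ?mulr0.
Qed.

(** Chains with the same odd vertices differ by an even chain, so no fibre of [odd_at] is larger
    than the one over the empty set. In other words, the cycle space has dimension at least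
    [|E| - |S| + 1]. *)
Lemma card_even_chains :
  (2 ^ #|E| <= #|[set s : {ffun E -> bool} | odd_at s == set0]| * 2 ^ #|S|.-1)%N.
Proof.
have -> : #|S|.-1 = #|S :\ v0| by rewrite (cardsD1 v0 S) v0S.
rewrite -card_powerset mulnC -sum_nat_const.
have -> : (2 ^ #|E| = \sum_(s : {ffun E -> bool}) 1)%N.
  by rewrite sum1_card card_ffun card_bool.
rewrite (partition_big odd_at (fun A => A \in powerset (S :\ v0))) /=; last first.
  by move=> s _; rewrite inE; apply/subsetP=> v; rewrite inE => /andP[].
apply: leq_sum => A _; rewrite sum1_card.
have [s0 /eqP As0|no] := pickP (fun s => odd_at s == A); last by rewrite eq_card0.
pose f (s : {ffun E -> bool}) := [ffun Y => s Y + s0 Y] : {ffun E -> bool}.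
have f_inj : injective f.
  by move=> s t /ffunP fst; apply/ffunP=> Y; have := fst Y; rewrite !ffunE => /addIr.
rewrite -(card_imset _ f_inj); apply: subset_leq_card; apply/subsetP=> _ /imsetP[s sA ->].
rewrite inE; apply/eqP/setP=> v; rewrite !inE.
have -> : boundary src tgt (f s) (fun t => t == v)
    = boundary src tgt s (fun t => t == v) + boundary src tgt s0 (fun t => t == v).
  by rewrite -boundaryD; apply: boundary_eq => Y; rewrite ffunE.
have ss0 : odd_at s = odd_at s0 by rewrite As0; apply/eqP.
have : (v \in odd_at s) = (v \in odd_at s0) by rewrite ss0.
rewrite !inE; case: ((v != v0) && (v \in S)) => //= ->; exact: addbb.
Qed.

Lemma sum_edge_degree : (\sum_(v in S) edge_degree (fun=> true) v = 2 * #|E|)%N.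
Proof.
rewrite exchange_big /= mulnC -sum_nat_const; apply: eq_bigr => Y _.
under eq_bigr do rewrite mul1n.
have one t : t \in S -> (\sum_(v in S) (t == v) = 1)%N.
  move=> tS; rewrite (bigD1 t) //= eqxx big1 // => v /andP[_ /negbTE].
  by rewrite eq_sym => ->.
by rewrite big_split /= !one.
Qed.

(** If all members in [F] weighed at least 12, then [12|F| <= 2B], as no edge is used more than
    twice. Now [2|E| = B + 2(|S| - N)] and [3N <= B] give [|E| - |S| >= B/6 >= |F|], while spanning
    forces [|F| >= |E| - |S| + 1]. *)
Lemma exists_light_cycle b : two_basis b ->
  (forall v, v \in S -> 2 <= edge_degree (fun=> true) v)%N ->
  exists s, [/\ even src tgt s, exists Y, s Y &
    (\sum_(v in S | 2 < edge_degree (fun=> true) v) edge_degree s v < 12)%N].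
Proof.
move=> [b_even b2 b_span] d2.
pose F := [set q | [exists Y, b q Y]].
pose B := (\sum_(v in S | 2 < edge_degree (fun=> true) v) edge_degree (fun=> true) v)%N.
pose N := #|[set v in S | 2 < edge_degree (fun=> true) v]%N|.
have [/exists_inP[q qF lt12]|] := boolP [exists q in F,
    \sum_(v in S | 2 < edge_degree (fun=> true) v) edge_degree (b q) v < 12]%N.
  by exists (b q); split=> //; move: qF; rewrite inE => /existsP.
rewrite negb_exists_in => /forall_inP ge12; exfalso.
have le12 : (12 * #|F| <= 2 * B)%N.
  rewrite mulnC -sum_nat_const.
  apply: leq_trans (_ : \sum_(q in F) \sum_(v in S | 2 < edge_degree (fun=> true) v)
    edge_degree (b q) v <= _)%N.
    by apply: leq_sum => q /ge12; rewrite -leqNgt.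
  rewrite exchange_big /= /B big_distrr; apply: leq_sum => v _.
  rewrite /edge_degree exchange_big /= big_distrr; apply: leq_sum => Y _.
  rewrite -big_distrl /= mul1n leq_mul2r; apply/orP; right.
  apply: leq_trans (b2 Y); rewrite -sum1_card [leqLHS]big_mkcond [leqRHS]big_mkcond /=.
  by apply: leq_sum => q _; rewrite inE; case: (q \in F); case: (b q Y).
have NB : (3 * N <= B)%N.
  rewrite mulnC -sum_nat_const /B big_mkcond [leqRHS]big_mkcond /=.
  by apply: leq_sum => v _; rewrite !inE; case: ifP => // /andP[].
have sumE : (2 * #|E| + 2 * N = B + 2 * #|S|)%N.
  rewrite -sum_edge_degree (bigID (fun v => 2 < edge_degree (fun=> true) v)%N) /= -/B.
  rewrite -addnA; congr addn.
  rewrite -(cardsID [set v | 2 < edge_degree (fun=> true) v]%N S) mulnDr addnC.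
  congr addn; first by congr (2 * _)%N; apply: eq_card => v; rewrite !inE.
  rewrite mulnC -sum_nat_const; apply: eq_big => [v|v /andP[vS]].
    by rewrite !inE andbC.
  by rewrite -leqNgt => le2; apply/eqP; rewrite eqn_leq le2 d2.
have S_gt0 : (0 < #|S|)%N by apply/card_gt0P; exists v0.
have : (2 ^ #|E| <= 2 ^ (#|F| + #|S|.-1))%N.
  apply: leq_trans card_even_chains _; rewrite expnD leq_mul2r; apply/orP; right.
  rewrite -card_powerset.
  pose g (A : {set Q}) := [ffun Y => \sum_(q in A) b q Y] : {ffun E -> bool}.
  apply: leq_trans (leq_imset_card g _); apply: subset_leq_card; apply/subsetP=> s.
  rewrite inE => /eqP/odd_at_even/b_span[c sc]; apply/imsetP.
  exists [set q in F | c q]; first by rewrite inE; apply/subsetP=> q; rewrite inE => /andP[].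
  apply/ffunP=> Y; rewrite sc ffunE [RHS]big_mkcond; apply: eq_bigr => q _ /=.
  rewrite !inE; case: (boolP (b q Y)) => bqY; last by rewrite mulr0 if_same.
  have -> /= : [exists Y, b q Y] by apply/existsP; exists Y.
  by case: (c q).
rewrite leq_exp2l //; lia.
Qed.

End Counting.

(** * From faces of a surface to a 2-basis of the graph *)

Section Duality.
Import GRing.Theory.
Local Open Scope ring_scope.

(* T, X and Q are the points, edges and faces of a closed surface, and beta   *)
(* sends the points of the branch set of u to Some u.                         *)
Variables (T Q X V E : finType) (a b : X -> T) (l r : X -> Q).
Variables (src tgt : E -> V) (beta : T -> option V) (xe : E -> X) (root_pt : V -> T).

Hypothesis coboundary_even : forall (c : Q -> bool) (chi : T -> bool),
  boundary a b (fun x => c (l x) + c (r x)) chi = 0.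
Hypothesis even_coboundary : forall z : X -> bool, even a b z ->
  (forall x, z x -> beta (a x) /\ beta (b x)) ->
  exists c : Q -> bool, forall x, z x = c (l x) + c (r x).
Hypothesis src_neq_tgt : forall Y, src Y != tgt Y.
Hypothesis xe_inj : injective xe.
Hypothesis xe_ends : forall Y,
  beta (a (xe Y)) = Some (src Y) /\ beta (b (xe Y)) = Some (tgt Y) \/
  beta (a (xe Y)) = Some (tgt Y) /\ beta (b (xe Y)) = Some (src Y).
Hypothesis fibre_chain : forall t u, beta t = Some u -> exists p : X -> bool,
  (forall x, p x -> beta (a x) = Some u /\ beta (b x) = Some u) /\
  forall chi, boundary a b p chi = chi t + chi (root_pt u).

(** These are the edges occupied by the model. Faces joined across the other edges form one region,
    named by its root. *)
Let used x := (x \in codom xe) || (beta (a x) == beta (b x)) && beta (a x).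
Let adj : rel Q := fun q q' => [exists x, ~~ used x &&
  ((l x == q) && (r x == q') || (l x == q') && (r x == q))].

Let adj_sym : symmetric adj.
Proof. by move=> q q'; apply: eq_existsb => x; rewrite orbC. Qed.

Let region_eq x : ~~ used x -> fingraph.root adj (l x) = fingraph.root adj (r x).
Proof.
move=> ux; apply/(fingraph.rootP (sym_connect_sym adj_sym)).
by apply: connect1; apply/existsP; exists x; rewrite ux !eqxx.
Qed.

(** The sum mod 2 discards an edge that has [q] on both sides. *)
Let bnd q Y : bool := (fingraph.root adj (l (xe Y)) == q : bool) + (fingraph.root adj (r (xe Y)) == q).

(** A test function on [V] pulls back along [beta] to one that is constant on branch sets, so the
    boundary of a region stays even when these are contracted. *)
Let bnd_even q : even src tgt (bnd q).
Proof.
move=> psi; pose chi t := if beta t is Some u then psi u else false.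
pose c q' : bool := fingraph.root adj q' == q.
rewrite -[RHS](coboundary_even c chi) /boundary.
rewrite [RHS](bigID (mem [set xe Y | Y in E])) /= [X in _ + X]big1 ?addr0.
  rewrite big_imset /=; last by move=> Y Y' _ _; apply: xe_inj.
  apply: eq_bigr => Y _; rewrite /chi.
  by case: (xe_ends Y) => -[-> ->]; rewrite // [psi (tgt Y) + _]addrC.
move=> x xN; case: (boolP (used x)) => [/orP[]|ux].
- by case/codomP=> Y xY; case/imsetP: xN; exists Y.
- by case/andP=> /eqP ab _; rewrite /chi ab [X in _ * X]addbb mulr0.
by rewrite /c region_eq // [X in X * _]addbb mul0r.
Qed.

Let bnd_two Y : (#|[set q | bnd q Y]| <= 2)%N.
Proof.
apply: leq_trans (_ : #|[set fingraph.root adj (l (xe Y)); fingraph.root adj (r (xe Y))]| <= _)%N.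
  apply: subset_leq_card; apply/subsetP=> q; rewrite !inE /bnd !(eq_sym _ q).
  by case: (q == _); case: (q == _).
by rewrite cards2; case: (_ != _).
Qed.

Let bnd_span s : even src tgt s ->
  exists c : Q -> bool, forall Y, s Y = \sum_q c q * bnd q Y.
Proof.
move=> s_even.
have /fin_all_exists[P PP] t : exists p : X -> bool, forall u, beta t = Some u ->
    (forall x, p x -> beta (a x) = Some u /\ beta (b x) = Some u) /\
    forall chi, boundary a b p chi = chi t + chi (root_pt u).
  case bt : (beta t) => [u|]; last by exists (fun=> false).
  by have [p pP] := fibre_chain bt; exists p => u' [<-].
pose zY Y x : bool := (x == xe Y : bool) + (P (a (xe Y)) x + P (b (xe Y)) x).
pose z x := \sum_Y s Y * zY Y x.
have zY_inner Y x : zY Y x -> beta (a x) /\ beta (b x).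
  rewrite /zY; case: eqP => [->|_]; first by case: (xe_ends Y) => -[-> ->].
  case Pa : (P _ x).
    by case: (xe_ends Y) => -[/PP[/(_ _ Pa)[-> ->]]].
  case Pb : (P _ x) => //.
  by case: (xe_ends Y) => -[_ /PP[/(_ _ Pb)[-> ->]]].
have [||c zc] := even_coboundary (z := z).
- move=> chi; rewrite boundary_sum -[RHS](s_even (chi \o root_pt)).
  apply: eq_bigr => Y _; rewrite boundaryMl; congr (_ * _).
  rewrite !boundaryD.
  have -> : boundary a b (fun x => x == xe Y) chi = chi (a (xe Y)) + chi (b (xe Y)).
    rewrite /boundary (bigD1 (xe Y)) //= eqxx mul1r big1 ?addr0 // => x /negbTE->.
    by rewrite mul0r.
  by case: (xe_ends Y) => -[/PP[_ ->] /PP[_ ->]] /=;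
    case: (chi _); case: (chi _); case: (chi _); case: (chi _).
- move=> x zx; have [Y /andP[_ /zY_inner//]] : exists Y, s Y && zY Y x.
  apply/existsP; apply: contraTT zx; rewrite negb_exists => /forallP no.
  by rewrite /z big1 // => Y _; apply/negbTE; exact: no.
have zY_unused Y x : ~~ used x -> zY Y x = 0.
  rewrite /zY negb_or => /andP[xN xN']; have -> : x == xe Y = false.
    by apply: contraNF xN => /eqP->; apply: codom_f.
  have no t : (exists u, beta t = Some u) -> P t x = false.
    move=> [u /PP[Px _]]; apply: contraNF xN' => /Px[-> ->].
    by rewrite eqxx.
  by case: (xe_ends Y) => -[ba bb]; rewrite !no //; eexists; eassumption.
have c_conn q q' : connect adj q q' -> c q = c q'.
  case/connectP=> p + ->; elim: p q => //= q1 p IH q /andP[/existsP[x /andP[ux xq]] /IH <-].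
  have : z x = 0 by rewrite /z big1 // => Y _; rewrite zY_unused ?mulr0.
  rewrite zc; case/orP: xq => /andP[/eqP -> /eqP ->];
  by case: (c q); case: (c q1).
exists c => Y.
(* The chains inside branch sets never use an edge [xe Y], whose ends lie in different branch
   sets. *)
have -> : s Y = z (xe Y).
  rewrite /z (bigD1 Y) //= big1 ?addr0; last first.
    move=> Y' nY; rewrite /zY; have -> : xe Y == xe Y' = false.
      by apply: contraNF nY => /eqP/xe_inj->.
    have no t : (exists u, beta t = Some u) -> P t (xe Y) = false.
      move=> [u /PP[Px _]]; apply: contraNF (src_neq_tgt Y) => /Px[].
      by case: (xe_ends Y) => -[-> ->] [->] [->].
    by case: (xe_ends Y') => -[ba bb]; rewrite !no ?mulr0 //; eexists; eassumption.
  rewrite /zY eqxx; have no t : (exists u, beta t = Some u) -> P t (xe Y) = false.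
    move=> [u /PP[Px _]]; apply: contraNF (src_neq_tgt Y) => /Px[].
    by case: (xe_ends Y) => -[-> ->] [->] [->].
  by case: (xe_ends Y) => -[ba bb]; rewrite !no ?mulr1 //; eexists; eassumption.
rewrite zc (c_conn _ _ (connect_root adj _)) (c_conn (r _) _ (connect_root adj _)).
have pick q' : c q' = \sum_q c q * (q' == q : bool).
  rewrite (bigD1 q') //= eqxx big1 ?addr0 ?mulr1 // => q nq.
  by rewrite eq_sym (negbTE nq) mulr0.
rewrite pick [c (fingraph.root adj (r _))]pick -big_split; apply: eq_bigr => q _.
by rewrite /= -mulrDr.
Qed.

Lemma surface_two_basis : exists bs : Q -> E -> bool, two_basis src tgt bs.
Proof. by exists bnd; split. Qed.

End Duality.

(** * From even edge sets to cycles of the graph *)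

Section GraphCycle.
Import GRing.Theory.

(** A path is prolonged at its first vertex, by a neighbour other than the second vertex, until that
    neighbour is already on the path. *)
Lemma exists_cycle (V : finType) (f : rel V) : symmetric f -> irreflexive f ->
  (exists u v, f u v) -> (forall u v, f u v -> exists2 w, w != v & f u w) ->
  exists c, [/\ 3 <= size c, uniq c & cycle f c].
Proof.
move=> f_sym f_irr [u [v fuv]] f2.
suff grow n : (exists c, [/\ 3 <= size c, uniq c & cycle f c]) \/
    exists x y p, [/\ uniq [:: x, y & p], path f x (y :: p) & size p = n].
  have [//|[x [y [p [up _ sp]]]]] := grow #|V|.
  by have := max_card [in [:: x, y & p]]; rewrite (card_uniqP up) /= sp => /ltnW; rewrite ltnn.
elim: n => [|n [|[x [y [p [up fp sp]]]]]].
- right; exists u, v, [::]; split; rewrite /= ?fuv // inE andbT.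
  by apply: contraTneq fuv => ->; rewrite f_irr.
- by left.
move: (fp) => /= /andP[fxy _]; have [w wy fxw] := f2 _ _ fxy.
have [wp|wp] := boolP (w \in [:: x, y & p]); last first.
  right; exists w, x, (y :: p); split; last by rewrite /= sp.
    by rewrite cons_uniq wp.
  by rewrite /= f_sym fxw.
left; have {}wp : w \in p.
  move: wp; rewrite !in_cons (negbTE wy) /=; case: eqP fxw => [->|//].
  by rewrite f_irr.
case/splitPr: wp up fp => p1 p2 up fp; exists [:: x, y & rcons p1 w]; split.
- by rewrite /= size_rcons.
- by move: up; rewrite -cat_rcons -!cat_cons cat_uniq => /andP[].
move: fp; rewrite -cat_rcons /= cat_path rcons_path => /and3P[fxy' fp1 _].
by rewrite /= fxy' !rcons_path fp1 last_rcons f_sym.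
Qed.

Variables (V : finType) (e : rel V).
Hypotheses (e_sym : symmetric e) (e_irr : irreflexive e).
Variable S : {set V}.

(* Every edge inside S is listed once, ordered along the enumeration of V.    *)
Definition inner_edge (p : V * V) :=
  [&& p.1 \in S, p.2 \in S, e p.1 p.2 & enum_rank p.1 < enum_rank p.2].

Let E := {p : V * V | inner_edge p}.
Definition edge_src (Y : E) := (val Y).1.
Definition edge_tgt (Y : E) := (val Y).2.

Lemma edge_of u v : u \in S -> v \in S -> e u v ->
  exists Y : E, edge_src Y = u /\ edge_tgt Y = v \/ edge_src Y = v /\ edge_tgt Y = u.
Proof.
move=> uS vS euv; case: (ltngtP (enum_rank u) (enum_rank v)) => [lt|lt|].
- have uvP : inner_edge (u, v) by apply/and4P.
  by exists (Sub (u, v) uvP); left; rewrite /edge_src /edge_tgt SubK.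
- have vuP : inner_edge (v, u) by apply/and4P; split; rewrite //= e_sym.
  by exists (Sub (v, u) vuP); right; rewrite /edge_src /edge_tgt SubK.
by move/ord_inj/enum_rank_inj=> uv; rewrite uv e_irr in euv.
Qed.

Lemma edge_srcS Y : edge_src Y \in S. Proof. by case/and4P: (valP Y). Qed.
Lemma edge_tgtS Y : edge_tgt Y \in S. Proof. by case/and4P: (valP Y). Qed.
Lemma edge_adj Y : e (edge_src Y) (edge_tgt Y). Proof. by case/and4P: (valP Y). Qed.

Lemma edge_src_neq_tgt Y : edge_src Y != edge_tgt Y.
Proof. by apply: contraTneq (edge_adj Y) => ->; rewrite e_irr. Qed.

Lemma edge_ends_inj Y Y' u v :
  edge_src Y = u /\ edge_tgt Y = v \/ edge_src Y = v /\ edge_tgt Y = u ->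
  edge_src Y' = u /\ edge_tgt Y' = v \/ edge_src Y' = v /\ edge_tgt Y' = u -> Y = Y'.
Proof.
have lt Z : enum_rank (edge_src Z) < enum_rank (edge_tgt Z) by case/and4P: (valP Z).
have := lt Y; have := lt Y'; move=> lt1 lt2.
move=> h1 h2; apply: val_inj; rewrite (surjective_pairing (val Y)).
rewrite (surjective_pairing (val Y')) -/(edge_src Y) -/(edge_tgt Y).
rewrite -/(edge_src Y') -/(edge_tgt Y').
case: h1 h2 => -[E1 E2] [] [E3 E4]; rewrite E1 E2 E3 E4 // in lt1 lt2 *; lia.
Qed.

Let s_adj (s : E -> bool) u v := [exists Y, s Y &&
  ((edge_src Y == u) && (edge_tgt Y == v) || (edge_src Y == v) && (edge_tgt Y == u))].

Let other (Y : E) v := if edge_src Y == v then edge_tgt Y else edge_src Y.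

Lemma edge_degree_card (s : E -> bool) v :
  edge_degree edge_src edge_tgt s v = #|[set w | s_adj s v w]|.
Proof.
have -> : [set w | s_adj s v w] =
    [set other Y v | Y in [pred Y | s Y && ((edge_src Y == v) || (edge_tgt Y == v))]].
  apply/setP=> w; rewrite inE; apply/existsP/imsetP=> [[Y /andP[sY]]|[Y]].
    move=> h; exists Y; first by rewrite inE sY; case/orP: h => /andP[h1 h2]; rewrite ?h1 ?h2 ?orbT.
    rewrite /other; case/orP: h => /andP[/eqP <- /eqP <-]; rewrite ?eqxx //.
    by rewrite (negbTE (edge_src_neq_tgt Y)).
  rewrite inE => /andP[sY h] ->; exists Y; rewrite sY /other /=.
  case: eqP h => [->|_] /=; first by rewrite !eqxx.
  by move=> ->; rewrite eqxx ?andbT ?orbT.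
rewrite card_in_imset => [|Y Y'].
  rewrite /edge_degree -sum1_card [RHS]big_mkcond; apply: eq_bigr => Y _.
  rewrite !inE; case: (s Y); rewrite ?mul0n // mul1n /=.
  case: eqP => [Yv|_] /=; last by case: eqP.
  by case: eqP => // Yv'; have := edge_src_neq_tgt Y; rewrite Yv Yv' eqxx.
rewrite !inE => /andP[_ h] /andP[_ h'] oY.
apply: (@edge_ends_inj _ _ v (other Y v)).
  by rewrite /other; case: eqP h => [->|_ /eqP ->]; [left|right].
by rewrite oY /other; case: eqP h' => [->|_ /eqP ->]; [left|right].
Qed.

Lemma edge_degree_nbrs v : v \in S ->
  edge_degree edge_src edge_tgt (fun=> true) v = #|[set u in S | e v u]|.
Proof.
move=> vS; rewrite edge_degree_card; apply: eq_card => w; rewrite !inE.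
apply/existsP/andP=> [[Y /= /orP[]/andP[/eqP <- /eqP <-]]|[wS evw]].
- by split; [apply: edge_tgtS | apply: edge_adj].
- by split; [apply: edge_srcS | rewrite e_sym; apply: edge_adj].
have [Y [] [<- <-]] := edge_of vS wS evw; exists Y; rewrite /= !eqxx ?orbT //.
Qed.

(** A vertex on a cycle inside [s] has degree at least 2 in [s], so six branch vertices would
    already weigh 12. *)
Lemma light_graph_cycle s : even edge_src edge_tgt s -> (exists Y, s Y) ->
  \sum_(v in S | 2 < #|[set u in S | e v u]|) edge_degree edge_src edge_tgt s v < 12 ->
  exists c, [/\ 3 <= size c, {subset c <= S}, uniq c, cycle e c
    & count [pred v | 2 < #|[set u in S | e v u]|] c <= 5].
Proof.
move=> s_even [Y0 sY0] lt12.
have adj_e u v : s_adj s u v -> [/\ u \in S, v \in S & e u v].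
  case/existsP=> Y /andP[_ /orP[]/andP[/eqP <- /eqP <-]].
    by split; [apply: edge_srcS | apply: edge_tgtS | apply: edge_adj].
  by split; [apply: edge_tgtS | apply: edge_srcS | rewrite e_sym; apply: edge_adj].
have deg2 u v : s_adj s u v -> 2 <= edge_degree edge_src edge_tgt s u.
  move=> uv; have : 0 < edge_degree edge_src edge_tgt s u.
    by rewrite edge_degree_card; apply/card_gt0P; exists v; rewrite inE.
  suff : ~~ odd (edge_degree edge_src edge_tgt s u) by lia.
  rewrite /edge_degree (big_morph odd oddD (erefl : odd 0 = false)).
  rewrite (_ : \big[addb/false]_Y _ = boundary edge_src edge_tgt s (fun t => t == u)).
    by rewrite s_even.
  by apply: eq_bigr => Y _; rewrite oddM oddD !oddb.
have [||||c [c3 uc fc]] := @exists_cycle V (s_adj s).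
- by move=> u v; apply: eq_existsb => Y; congr (_ && _); rewrite orbC.
- by move=> u; apply/negbTE/negP=> uu; have [_ _] := adj_e _ _ uu; rewrite e_irr.
- by exists (edge_src Y0), (edge_tgt Y0); apply/existsP; exists Y0; rewrite sY0 !eqxx.
- move=> u v uv; have := deg2 _ _ uv; rewrite edge_degree_card (cardsD1 v) inE uv.
  rewrite ltnS => /card_gt0P[w]; rewrite !inE => /andP[wv uw].
  by exists w.
have c_adj v : v \in c -> exists w, s_adj s v w.
  by move=> vc; exists (next c v); apply: next_cycle.
exists c; split=> //.
- by move=> v /c_adj[w /adj_e[]].
- by apply: sub_cycle fc => u v /adj_e[].
rewrite -ltnS -(ltn_pmul2l (isT : 0 < 2)); apply: leq_ltn_trans lt12.
rewrite -sum1_count big_distrr [leqLHS]big_mkcond big_uniq //=.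
rewrite [leqLHS]big_mkcond [leqRHS]big_mkcond /=.
apply: leq_sum => v _; case: (boolP (v \in c)) => //= vc.
have [w vw] := c_adj v vc; have [-> _ _] := adj_e _ _ vw.
by case: ifP => //= _; apply: deg2 vw.
Qed.

End GraphCycle.

(** * Homology of the torus grid mod 2 *)

Section Torus.
Import GRing.Theory.
Local Open Scope ring_scope.

Variable n : nat.

Let T := ('I_n.+1 * 'I_n.+1)%type.
Let X := (bool * T)%type.
Implicit Types (t : T) (x : X) (d : bool) (chi : T -> bool).

Definition succ_pt d t : T := if d then (ordS t.1, t.2) else (t.1, ordS t.2).
Definition pred_pt d t : T := if d then (ord_pred t.1, t.2) else (t.1, ord_pred t.2).

Lemma succ_ptK d : cancel (succ_pt d) (pred_pt d).
Proof. by move=> [i j]; rewrite /succ_pt /pred_pt; case: d => /=; rewrite ordSK. Qed.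

Lemma pred_ptK d : cancel (pred_pt d) (succ_pt d).
Proof. by move=> [i j]; rewrite /succ_pt /pred_pt; case: d => /=; rewrite ord_predK. Qed.

Lemma sum_succ d (F : T -> bool) : \sum_t F t = \sum_t F (succ_pt d t).
Proof. by apply: reindex_inj; apply: can_inj (succ_ptK d). Qed.

(* The edge (d, t) joins t to succ_pt d t and separates the face whose lower  *)
(* left corner is t from its neighbour in the other direction.                *)
Definition edge_fst (x : X) : T := x.2.
Definition edge_snd (x : X) : T := succ_pt x.1 x.2.
Definition edge_left (x : X) : T := x.2.
Definition edge_right (x : X) : T := pred_pt (~~ x.1) x.2.

Lemma sum_edges (F : X -> bool) : \sum_x F x = \sum_t F (true, t) + \sum_t F (false, t).
Proof.
have -> : \sum_x F x = \sum_d \sum_t F (d, t) by rewrite pair_bigA; apply: eq_bigr => -[].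
by rewrite big_bool.
Qed.

(** Each face contributes the sum of [chi] over its four corners twice, once from the edges of each
    direction. *)
Lemma torus_coboundary_even (c chi : T -> bool) :
  boundary edge_fst edge_snd (fun x => c (edge_left x) + c (edge_right x)) chi = 0.
Proof.
rewrite /boundary sum_edges /edge_fst /edge_snd /edge_left /edge_right /=.
have expand d : \sum_t (c t + c (pred_pt (~~ d) t)) * (chi t + chi (succ_pt d t)) =
    \sum_t c t * chi t + \sum_t c t * chi (succ_pt d t) +
    (\sum_t c t * chi (succ_pt (~~ d) t) + \sum_t c t * chi (succ_pt true (succ_pt false t))).
  rewrite [X in _ + (_ + X)](_ : _ = \sum_t c (pred_pt (~~ d) t) * chi (succ_pt d t)).
    rewrite [X in _ + (X + _)](_ : _ = \sum_t c (pred_pt (~~ d) t) * chi t).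
      by rewrite -!big_split; apply: eq_bigr => t _; rewrite mulrDl !mulrDr.
    by rewrite [RHS](sum_succ (~~ d)); apply: eq_bigr => t _; rewrite succ_ptK.
  rewrite [RHS](sum_succ (~~ d)); apply: eq_bigr => t _; rewrite succ_ptK.
  by case: d.
rewrite (expand true) (expand false) /=.
move: (\sum_t _) (\sum_t _) (\sum_t _) (\sum_t _) => [] [] [] [] //.
Qed.

Lemma boundary_at (z : X -> bool) t :
  boundary edge_fst edge_snd z (fun t' => t' == t) =
  z (true, t) + z (true, pred_pt true t) + (z (false, t) + z (false, pred_pt false t)).
Proof.
have pick (F : T -> bool) t0 : \sum_t' F t' * (t' == t0 : bool) = F t0.
  rewrite (bigD1 t0) //= eqxx mulr1 big1 ?addr0 // => t' /negbTE->.
  by rewrite mulr0.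
have pick_succ d (F : T -> bool) t0 : \sum_t' F t' * (succ_pt d t' == t0 : bool) = F (pred_pt d t0).
  rewrite -(pick F (pred_pt d t0)); apply: eq_bigr => t' _; congr (_ * _).
  by apply/eqP/eqP=> [<-|->]; rewrite ?succ_ptK ?pred_ptK.
rewrite /boundary sum_edges /edge_fst /edge_snd /=; congr (_ + _).
  under eq_bigr do rewrite mulrDr.
  by rewrite big_split /= (pick (fun t => z (true, t))) (pick_succ true (fun t => z (true, t))).
under eq_bigr do rewrite mulrDr.
by rewrite big_split /= (pick (fun t => z (false, t))) (pick_succ false (fun t => z (false, t))).
Qed.

(** The value at a face counts the edges of the chain crossed on the way from the border; evenness
    at the points makes this consistent in the other direction. On the whole torus a meridian is
    even without bounding; leaving out the last row and column makes the count return to 0 after a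
    full turn. *)
Lemma torus_even_coboundary (z : X -> bool) :
  even edge_fst edge_snd z ->
  (forall x, z x -> (edge_fst x).1 < n /\ (edge_fst x).2 < n)%N ->
  exists c : T -> bool, forall x, z x = c (edge_left x) + c (edge_right x).
Proof.
move=> z_even z_in.
pose zN d i j := z (d, (inord i, inord j)).
pose pr i := if i is i'.+1 then i' else n.
have ord_prE i : (i <= n)%N -> ord_pred (inord i : 'I_n.+1) = inord (pr i).
  move=> lei; apply: val_inj; rewrite /= inordK //.
  case: i lei => [|i] lei; rewrite /pr inordK ?ltnS //; last exact: ltnW.
    by rewrite add0n modn_small.
  by rewrite addSn /= modnDr modn_small // ltnS ltnW.
have local i j : (i <= n)%N -> (j <= n)%N ->
    zN true i j + zN true (pr i) j = zN false i j + zN false i (pr j).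
  move=> lei lej; have := z_even (fun t => t == (inord i, inord j)).
  rewrite boundary_at /pred_pt /= !ord_prE // -/(zN true i j).
  rewrite -/(zN true (pr i) j) -/(zN false i j) -/(zN false i (pr j)).
  by case: (zN true i j); case: (zN true (pr i) j);
    case: (zN false i j); case: (zN false i (pr j)).
have z_last d i j : (i = n \/ j = n) -> zN d i j = 0.
  move=> lst; apply/negbTE/negP=> /z_in[] /=.
  by case: lst => -> => [|_]; rewrite inordK // ltnn.
pose cN i j := \sum_(m < j.+1) zN true i m.
have vert i j : (i <= n)%N -> (j <= n)%N -> cN i j + cN (pr i) j = zN false i j.
  move=> lei; elim: j => [|j IHj] lej; rewrite /cN.
    by rewrite !big_ord1 local // [X in _ + X]z_last ?addr0 //; right.
  rewrite big_ord_recr [X in _ + X]big_ord_recr /= -/(cN i j) -/(cN (pr i) j).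
  rewrite addrACA IHj ?local //=; last exact: ltnW.
  by rewrite addrCA [X in _ + X]addbb addr0.
have col0 i : (i <= n)%N -> cN i n = 0.
  have prc k : (k <= n)%N -> cN k n = cN (pr k) n.
    move=> lek; have := vert k n lek (leqnn n); rewrite z_last; last by right.
    by case: (cN k n); case: (cN (pr k) n).
  elim: i => [|i IHi] lei; rewrite prc //=; last exact: IHi (ltnW lei).
  by rewrite /cN big1 // => m _; apply: z_last; left.
have ordE (k : 'I_n.+1) : inord k = k by apply: inord_val.
have leo (k : 'I_n.+1) : (k <= n)%N by rewrite -ltnS.
have predE (k : 'I_n.+1) : ord_pred k = pr k :> nat.
  rewrite -{1}(ordE k) ord_prE // inordK // ltnS.
  by rewrite /pr; case: (k : nat) (leo k) => // k' /ltnW.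
have horiz i j : z (true, (i, j)) = cN i j + cN i (ord_pred j).
  rewrite predE; have -> : z (true, (i, j)) = zN true i j by rewrite /zN !ordE.
  case: (nat_of_ord j) => [|m] /=.
    by rewrite col0 // addr0 /cN big_ord1.
  by rewrite /cN big_ord_recr /= addrAC [X in X + _]addbb add0r.
have vertical i j : z (false, (i, j)) = cN i j + cN (ord_pred i) j.
  by rewrite predE vert // /zN !ordE.
by exists (fun t => cN t.1 t.2) => -[[] [i j]]; [apply: horiz | apply: vertical].
Qed.

End Torus.

(** * Minor models in a grid *)

Section GridModel.
Import GRing.Theory.
Local Open Scope ring_scope.
Variables (V : finType) (e : rel V).
Hypotheses (e_sym : symmetric e) (e_irr : irreflexive e).

Definition grid_adj (p q : nat * nat) : bool :=
  (p.1 == q.1) && ((p.2.+1 == q.2) || (q.2.+1 == p.2)) ||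
  (p.2 == q.2) && ((p.1.+1 == q.1) || (q.1.+1 == p.1)).

(* A minor model of the graph in the n x n grid: the branch set of u consists *)
(* of the points that beta sends to Some u.                                   *)
Definition grid_model (n : nat) (beta : nat * nat -> option V) :=
  [/\ forall p, beta p -> (p.1 < n)%N /\ (p.2 < n)%N,
      forall u, exists p0, forall p, beta p = Some u -> exists s,
        [/\ path grid_adj p0 s, last p0 s = p
          & forall q, q \in p0 :: s -> beta q = Some u]
    & forall u v, e u v -> exists p q,
        [/\ grid_adj p q, beta p = Some u & beta q = Some v]].

(** The torus has one more row and column than the grid, and the model leaves them free. *)
Lemma grid_two_basis n beta (S : {set V}) : grid_model n beta ->
  exists (Q : finType) (b : Q -> _ -> bool),
    two_basis (@edge_src _ e S) (@edge_tgt _ e S) b.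
Proof.
move=> [beta_in conn edges].
pose T := ('I_n.+1 * 'I_n.+1)%type; pose X := (bool * T)%type.
pose num (t : T) := (nat_of_ord t.1, nat_of_ord t.2).
pose tor (p : nat * nat) : T := (inord p.1, inord p.2).
have torK p : beta p -> num (tor p) = p.
  by move=> /beta_in[p1 p2]; rewrite /num /tor /= !inordK ?(leqW p1) ?(leqW p2) -?surjective_pairing // ltnW.
have numK t : tor (num t) = t.
  by case: t => i j; rewrite /tor /num /= !inord_val.
pose bt t := beta (num t).
have succ_tor p d : (p.1 < n)%N -> (p.2 < n)%N -> succ_pt d (tor p) =
    tor (if d then (p.1.+1, p.2) else (p.1, p.2.+1)).
  move=> p1 p2; rewrite /succ_pt /tor; case: d => /=; congr pair; apply: val_inj;
  by rewrite /= !inordK ?ltnS ?modn_small ?ltnS // ltnW.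
have adj_edge p q : grid_adj p q -> beta p -> beta q -> exists x : X,
    edge_fst x = tor p /\ edge_snd x = tor q \/ edge_fst x = tor q /\ edge_snd x = tor p.
  move=> pq /beta_in[p1 p2] /beta_in[q1 q2]; rewrite /edge_fst /edge_snd.
  case/orP: pq => /andP[/eqP E /orP[]/eqP E'].
  - exists (false, tor p); left; split; rewrite ?(succ_tor p false) //; congr tor.
    by rewrite /= E E' -surjective_pairing.
  - exists (false, tor q); right; split; rewrite ?(succ_tor q false) //; congr tor.
    by rewrite /= -E E' -surjective_pairing.
  - exists (true, tor p); left; split; rewrite ?(succ_tor p true) //; congr tor.
    by rewrite /= E E' -surjective_pairing.
  exists (true, tor q); right; split; rewrite ?(succ_tor q true) //; congr tor.
  by rewrite /= -E E' -surjective_pairing.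
(* The boundary of a path telescopes to its two ends. *)
have chain u s p0 : path grid_adj p0 s -> (forall q, q \in p0 :: s -> beta q = Some u) ->
    exists p : X -> bool, (forall x, p x -> bt (edge_fst x) = Some u /\ bt (edge_snd x) = Some u) /\
    forall chi, boundary (@edge_fst n) (@edge_snd n) p chi = chi (tor (last p0 s)) + chi (tor p0).
  elim: s p0 => [|q s IHs] p0 /=.
    move=> _ _; exists (fun=> false); split=> // chi.
    by rewrite [RHS]addbb; apply: big1 => x _; rewrite mul0r.
  case/andP=> pq ps bu; have bp0 : beta p0 = Some u by apply: bu; rewrite mem_head.
  have bq : beta q = Some u by apply: bu; rewrite !inE eqxx orbT.
  have [|p [pin pb]] := IHs q ps; first by move=> q' q's; apply: bu; rewrite inE q's orbT.
  have [||x xpq] := adj_edge p0 q pq; rewrite ?bp0 ?bq //.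
  exists (fun y => (y == x : bool) + p y); split=> [y|chi].
    case: eqP => [->|_ /pin//] _; rewrite /bt.
    by case: xpq => -[-> ->]; rewrite !torK ?bp0 ?bq.
  rewrite boundaryD pb.
  have -> : boundary (@edge_fst n) (@edge_snd n) (fun y => y == x) chi = chi (tor p0) + chi (tor q).
    rewrite /boundary (bigD1 x) //= eqxx mul1r big1 ?addr0 => [|y /negbTE->].
      by case: xpq => -[-> ->]; rewrite // addrC.
    by rewrite mul0r.
  by case: (chi _); case: (chi _); case: (chi _).
have /fin_all_exists[p0 p0P] := conn.
have /fin_all_exists[xe xeP] (Y : {p | inner_edge e S p}) : exists x : X,
    bt (edge_fst x) = Some (edge_src Y) /\ bt (edge_snd x) = Some (edge_tgt Y) \/
    bt (edge_fst x) = Some (edge_tgt Y) /\ bt (edge_snd x) = Some (edge_src Y).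
  have [p [q [pq bp bq]]] := edges _ _ (edge_adj Y).
  have [||x xpq] := adj_edge p q pq; rewrite ?bp ?bq //; exists x; rewrite /bt.
  by case: xpq => -[-> ->]; [left|right]; rewrite !torK ?bp ?bq.
exists T; apply: (@surface_two_basis T T X V _ (@edge_fst n) (@edge_snd n)
  (@edge_left n) (@edge_right n) _ _ bt xe (tor \o p0)) => //.
- exact: torus_coboundary_even.
- move=> z z_even z_in; apply: torus_even_coboundary => // x /z_in[/beta_in + _].
  exact.
- by move=> Y; apply: edge_src_neq_tgt.
- move=> Y Y' xYY'; apply: (@edge_ends_inj _ _ _ Y Y' (edge_src Y) (edge_tgt Y)).
    by left.
  have := xeP Y'; rewrite -xYY'.
  by case: (xeP Y) => -[-> ->] [] [[->] [->]]; [left|right|right|left].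
move=> t u tu; have [s [ps ls bs]] := p0P u _ tu.
have [p [pin pb]] := chain u s (p0 u) ps bs; exists p; split=> // chi.
by rewrite pb ls numK.
Qed.

End GridModel.

Require Import Defs.
From mathcomp Require Import all_classical all_reals all_analysis.
From mathcomp Require Import lra.

Import Order.TTheory GRing.Theory Num.Theory.
Import numFieldNormedType.Exports.

(** * Connectedness and separation in metric terms *)

Section Chains.
Local Open Scope classical_set_scope.
Local Open Scope ring_scope.
Variables (R : realType) (T : pseudoMetricType R).
Implicit Types (K L : set T) (p q : T) (eps : R).

Inductive eps_chain K eps p : T -> Prop :=
| eps_chain_refl : K p -> eps_chain K eps p p
| eps_chain_step q q' : eps_chain K eps p q -> ball q eps q' -> K q' -> eps_chain K eps p q'.

(** The points reachable from [p] form a subset that is open and closed in [K]. *)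
Lemma connected_eps_chain K eps p q : 0 < eps -> connected K -> K p -> K q ->
  eps_chain K eps p q.
Proof.
move=> eps0 Kc Kp Kq.
have chainK q' : eps_chain K eps p q' -> K q' by case.
pose B := [set q' | eps_chain K eps p q'].
suff BK : B = K by rewrite -[eps_chain _ _ _ _]/(B q) BK.
apply: Kc.
- by exists p; apply: eps_chain_refl.
- exists (\bigcup_(x in B) (ball x eps)°).
    by apply: bigcup_open => x _; apply: open_interior.
  apply/seteqP; split=> [x Bx|x [Kx [y By yx]]].
    by split; [exact: chainK | exists x => //; apply: nbhsx_ballx].
  by apply: eps_chain_step By _ Kx; apply: interior_subset yx.
exists (closure B); first exact: closed_closure.
apply/seteqP; split=> [x Bx|x [Kx clx]].
  by split; [exact: chainK | apply: subset_closure].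
have [y [By xy]] := clx _ (nbhsx_ballx x eps eps0).
by apply: eps_chain_step By _ Kx; apply: ball_sym.
Qed.

(** Stated for all small [r], so that finitely many separations can be combined by intersecting
    filter sets. *)
Lemma compact_closed_separated K L : compact K -> closed L ->
  (forall p, K p -> ~ L p) ->
  \forall r \near 0^'+, forall p q, K p -> L q -> ~ ball p r q.
Proof.
move=> Kc Lc KL.
pose P (r : R) p := forall q, L q -> ~ ball p r q.
have /compact_near_coveringP/near_covering_withinP := Kc.
move=> /(_ _ (0 : R)^'+ P) H.
suff : \forall r \near 0^'+, K `<=` P r.
  by apply: filterS => r KP p q Kp; apply: KP.
apply: H => p Kp; have : nbhs p (~` L).
  by apply: open_nbhs_nbhs; split; [apply: closed_openC | apply: KL].
move=> /nbhs_ballP[eps /= eps0 pL].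
exists (ball p (eps / 2), [set r : R | r < eps / 2]) => /=.
  split; first by apply: nbhsx_ballx; rewrite divr_gt0.
  by apply: nbhs_right_lt; rewrite divr_gt0.
move=> [p' r] /= [pp' reps] Kp' q Lq p'q; apply: (pL q) => //.
by apply: (le_ball _ (ball_triangle pp' p'q)); lra.
Qed.

End Chains.

(** * Quantitative separation in a plane drawing *)

Section Separation.
Local Open Scope classical_set_scope.
Local Open Scope ring_scope.
Variables (R : realType) (V : finType) (e : rel V).
Variables (pos : V -> R * R) (arc : {set V} -> set (R * R)).
Hypothesis drawing : plane_drawing e pos arc.

Lemma arc_start u v : e u v -> arc [set u; v]%SET (pos u).
Proof.
move=> euv; have [_ + _ _] := drawing => /(_ _ _ euv)[f [_ _ <- _ ->]].
by exists 0 => //=; rewrite in_itv /= lexx ler01.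
Qed.

Lemma arc_end u v : e u v -> arc [set u; v]%SET (pos v).
Proof.
move=> euv; have [_ + _ _] := drawing => /(_ _ _ euv)[f [_ _ _ <- ->]].
by exists 1 => //=; rewrite in_itv /= lexx ler01.
Qed.

Lemma arc_compact u v : e u v -> compact (arc [set u; v]%SET).
Proof.
move=> euv; have [_ + _ _] := drawing => /(_ _ _ euv)[f [fc _ _ _ ->]].
by apply: continuous_compact => //; apply: segment_compact.
Qed.

Lemma arc_connected u v : e u v -> connected (arc [set u; v]%SET).
Proof.
move=> euv; have [_ + _ _] := drawing => /(_ _ _ euv)[f [fc _ _ _ ->]].
by apply: connected_continuous_connected => //; apply: segment_connected.
Qed.

Lemma arc_closed u v : e u v -> closed (arc [set u; v]%SET).
Proof. by move=> /arc_compact; apply: compact_closed; apply: norm_hausdorff. Qed.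

Let near_implies (P : Prop) (Q : R -> Prop) :
  (P -> \forall r \near 0^'+, Q r) -> \forall r \near 0^'+, P -> Q r.
Proof.
move=> PQ; have [p|np] := pselect P; last by apply: nearW => r /np.
by apply: filterS (PQ p).
Qed.

Lemma vertices_separated : exists2 r : R, 0 < r &
  (forall u v, u <> v -> ~ ball (pos u) r (pos v)) /\
  (forall u v w p, e u v -> w <> u -> w <> v -> arc [set u; v]%SET p -> ~ ball (pos w) r p).
Proof.
have [pos_inj _ arc_vtx _] := drawing.
have closed1 (p : R * R) : closed [set p].
  by apply: accessible_closed_set1; apply: hausdorff_accessible; apply: norm_hausdorff.
have n1 : \forall r \near (0 : R)^'+, forall u v, u <> v -> ~ ball (pos u) r (pos v).
  apply: filter_forall => u; apply: filter_forall => v; apply: near_implies => uv.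
  apply: (filterS _ (compact_closed_separated (@compact_set1 _ (pos u)) (closed1 (pos v)) _)).
    by move=> r /(_ (pos u) (pos v)); apply.
  by move=> p -> /pos_inj.
have n2 : \forall r \near (0 : R)^'+, forall u v w, e u v /\ w <> u /\ w <> v -> forall p,
    arc [set u; v]%SET p -> ~ ball (pos w) r p.
  apply: filter_forall => u; apply: filter_forall => v; apply: filter_forall => w.
  apply: near_implies => -[euv [wu wv]].
  apply: (filterS _ (compact_closed_separated (@compact_set1 _ (pos w)) (arc_closed euv) _)).
    by move=> r /(_ (pos w)) sep p Ap; apply: sep.
  by move=> p -> /(arc_vtx _ _ _ euv)[].
have n0 : \forall r \near (0 : R)^'+, 0 < r by apply: nbhs_right_gt.
have [r [[r1 r2] r0]] := filter_ex (filterI (filterI n1 n2) n0).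
by exists r => //; split=> // u v w p euv wu wv; apply: r2.
Qed.

(** Outside open balls around the vertices, what is left of an arc is compact and misses every other
    arc. *)
Lemma arcs_separated (r : R) : 0 < r -> exists2 h : R, 0 < h &
  forall u v x y p q, e u v -> e x y -> [set u; v]%SET <> [set x; y]%SET ->
    arc [set u; v]%SET p -> arc [set x; y]%SET q -> ball p h q ->
    exists w, ball (pos w) r p.
Proof.
move=> r0; have [_ _ _ arcI] := drawing.
pose O := \bigcup_(w in [set: V]) (ball (pos w) r)°.
have oO : open O by apply: bigcup_open => w _; apply: open_interior.
have n1 : \forall h \near (0 : R)^'+, forall u v x y,
    e u v /\ e x y /\ [set u; v]%SET <> [set x; y]%SET -> forall p q,
    (arc [set u; v]%SET `&` ~` O) p -> arc [set x; y]%SET q -> ~ ball p h q.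
  apply: filter_forall => u; apply: filter_forall => v.
  apply: filter_forall => x; apply: filter_forall => y.
  apply: near_implies => -[euv [exy uvxy]].
  apply: compact_closed_separated; last 1 first.
  - move=> p [Ap Op] Bp; apply: Op; have [w _ wp] := arcI _ _ _ _ euv exy uvxy p (conj Ap Bp).
    by exists w => //; rewrite -wp; apply: nbhsx_ballx.
  - by apply: compact_closedI; [apply: arc_compact | apply: open_closedC].
  exact: arc_closed.
have n0 : \forall h \near (0 : R)^'+, 0 < h by apply: nbhs_right_gt.
have [h [h1 h0]] := filter_ex (filterI n1 n0).
exists h => // u v x y p q euv exy uvxy Ap Aq pq.
have [[w _ wp]|Op] := pselect (O p); first by exists w; apply: interior_subset wp.
by case: (h1 u v x y (conj euv (conj exy uvxy)) p q).
Qed.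

Lemma drawing_bounded : exists2 M : R, 0 < M & forall p,
  (exists u, p = pos u) \/ (exists u v, e u v /\ arc [set u; v]%SET p) ->
  `|p.1| <= M /\ `|p.2| <= M.
Proof.
have bnd (A : set (R * R)) : compact A -> \forall M \near +oo, forall p, A p -> `|p| <= M.
  by move=> /compact_bounded.
have n1 : \forall M \near +oo, forall u p, [set pos u] p -> `|p| <= M.
  by apply: filter_forall => u; apply: bnd; exact: compact_set1.
have n2 : \forall M \near +oo, forall u v, e u v -> forall p, arc [set u; v]%SET p -> `|p| <= M.
  apply: filter_forall => u; apply: filter_forall => v.
  have [euv|nuv] := boolP (e u v); last by apply: nearW.
  by apply: filterS (bnd _ (arc_compact euv)) => M hM _.
have n0 : \forall M \near +oo, (0 : R) < M by apply: nbhs_pinfty_gt.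
have [M [[M1 M2] M0]] := filter_ex (filterI (filterI n1 n2) n0).
exists M => // p hp; suff : `|p| <= M.
  rewrite prod_normE ge_max => /andP[]//.
by case: hp => [[u ->]|[u [v [euv Ap]]]]; [apply: (M1 u) | apply: M2 Ap].
Qed.

End Separation.

(** * Paths in the grid and discretization *)

Section Reach.
Local Open Scope nat_scope.
Variable P : nat * nat -> Prop.

Definition reach (p q : nat * nat) := exists s,
  [/\ path grid_adj p s, last p s = q & forall c, c \in p :: s -> P c].

Lemma reach_refl p : P p -> reach p p.
Proof. by move=> Pp; exists [::]; split=> // c; rewrite inE => /eqP->. Qed.

Lemma reach_step p q : P p -> P q -> grid_adj p q -> reach p q.
Proof.
move=> Pp Pq pq; exists [:: q]; split; rewrite /= ?pq // => c.
by rewrite !inE => /orP[]/eqP->.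
Qed.

Lemma reach_trans q p t : reach p q -> reach q t -> reach p t.
Proof.
case=> s1 [ps1 ls1 Ps1] [s2 [ps2 ls2 Ps2]]; exists (s1 ++ s2).
rewrite cat_path ps1 last_cat ls1; split=> // c.
rewrite -cat_cons mem_cat => /orP[/Ps1//|cs2].
by apply: Ps2; rewrite inE cs2 orbT.
Qed.

Lemma reach_segment (F : nat -> nat * nat) i j :
  (forall k, grid_adj (F k) (F k.+1) /\ grid_adj (F k.+1) (F k)) ->
  (forall k, minn i j <= k <= maxn i j -> P (F k)) -> reach (F i) (F j).
Proof.
move=> Fadj; have [m] := ubnP ((i - j) + (j - i)); elim: m i => // m IHm i lem PF.
have PFi : P (F i) by apply: PF; lia.
have [ltij|ltji|<-] := ltngtP i j; last exact: reach_refl.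
  apply: (@reach_trans (F i.+1)).
    by apply: reach_step => //; [apply: PF; lia | case: (Fadj i)].
  by apply: IHm => [|k lek]; [lia | apply: PF; lia].
case: i lem PF PFi ltji => // i lem PF PFi ltji.
apply: (@reach_trans (F i)).
  by apply: reach_step => //; [apply: PF; lia | case: (Fadj i)].
by apply: IHm => [|k lek]; [lia | apply: PF; lia].
Qed.

Lemma reach_corner p q :
  (forall k, minn p.1 q.1 <= k <= maxn p.1 q.1 -> P (k, p.2)) ->
  (forall k, minn p.2 q.2 <= k <= maxn p.2 q.2 -> P (q.1, k)) -> reach p q.
Proof.
case: p q => [i j] [i' j'] /= P1 P2; apply: (@reach_trans (i', j)).
  apply: (@reach_segment (fun k => (k, j))) => // k.
  by rewrite /grid_adj /= !eqxx ?orbT.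
apply: (@reach_segment (fun k => (i', k))) => // k.
by rewrite /grid_adj /= !eqxx ?orbT.
Qed.

End Reach.

Lemma between_step a b k : (a <= b.+1)%N -> (b <= a.+1)%N ->
  (minn a b <= k <= maxn a b)%N -> k = a \/ k = b.
Proof. lia. Qed.

Section Grid.
Local Open Scope ring_scope.
Variables (R : realType) (M d : R).
Hypothesis d_gt0 : 0 < d.
Implicit Types (p q : R * R) (c : nat * nat).

Lemma ball_pairP p (r : R) q : ball p r q <-> `|p.1 - q.1| < r /\ `|p.2 - q.2| < r.
Proof. by split=> [[]|[h1 h2]]; [|split]; rewrite -?ball_normE. Qed.

Definition grid_pt c : R * R := (c.1%:R * d - M, c.2%:R * d - M).
Definition cell p : nat * nat := (Num.truncn ((p.1 + M) / d), Num.truncn ((p.2 + M) / d)).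

Let truncn_near (x : R) : - M <= x -> `|x - ((Num.truncn ((x + M) / d))%:R * d - M)| < d.
Proof.
move=> Mx; have x0 : 0 <= (x + M) / d by apply: divr_ge0; [lra | exact: ltW].
have := truncn_itv x0; rewrite ler_pdivlMr // ltr_pdivrMr //.
rewrite -[in X in _ && X]natr1 [in X in _ && X]mulrDl mul1r ltr_norml.
by move: (_%:R * d) => y; lra.
Qed.

Let truncn_step (x y : R) : - M <= x -> - M <= y -> `|x - y| < d ->
  (Num.truncn ((x + M) / d) <= (Num.truncn ((y + M) / d)).+1)%N.
Proof.
move=> Mx My; rewrite ltr_norml => /andP[_ xy].
have x0 : 0 <= (x + M) / d by apply: divr_ge0; [lra | exact: ltW].
have y0 : 0 <= (y + M) / d by apply: divr_ge0; [lra | exact: ltW].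
have := truncn_itv y0; rewrite -ltnS truncn_lt_nat // => /andP[_].
rewrite !ltr_pdivrMr // -[in X in _ -> X]natr1 [(_ + 1) * _]mulrDl mul1r.
by move: (_%:R * d) => z; lra.
Qed.

Lemma cell_near p : - M <= p.1 -> - M <= p.2 -> ball p d (grid_pt (cell p)).
Proof. by move=> p1 p2; apply/ball_pairP; split; apply: truncn_near. Qed.

(** Consecutive points of the chain lie in cells that differ by at most one in each coordinate, and
    the L-shaped path between these cells stays within [2d] of the earlier point. *)
Lemma eps_chain_reach (K : set (R * R)) p q :
  (forall q, K q -> - M <= q.1 /\ - M <= q.2) -> eps_chain K d p q ->
  reach (fun c => exists2 p', K p' & ball p' (2 * d) (grid_pt c)) (cell p) (cell q).
Proof.
move=> KM; elim=> [Kp|q1 q2 c1 IH q12 Kq2].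
  apply: reach_refl; exists p => //; have [p1 p2] := KM _ Kp.
  have d2 : d <= 2 * d by rewrite ler_peMl ?ler1n // ltW.
  exact: le_ball d2 _ (cell_near p1 p2).
have Kq1 : K q1 by case: c1.
have [x1 y1] := KM _ Kq1; have [x2 y2] := KM _ Kq2.
have /ball_pairP[n1x n1y] := cell_near x1 y1; have /ball_pairP[n2x n2y] := cell_near x2 y2.
have /ball_pairP[qx qy] := q12.
have qx' : `|q2.1 - q1.1| < d by rewrite distrC.
have qy' : `|q2.2 - q1.2| < d by rewrite distrC.
have lx := truncn_step x1 x2 qx; have lx' := truncn_step x2 x1 qx'.
have ly := truncn_step y1 y2 qy; have ly' := truncn_step y2 y1 qy'.
have lt2 (x y z : R) : `|x - y| < d -> `|y - z| < d -> `|x - z| < 2 * d.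
  move=> xy yz; apply: le_lt_trans (ler_distD y _ _) _.
  by rewrite mulr_natl mulr2n ltrD.
have lt1 (x : R) : `|x| < d -> `|x| < 2 * d.
  by move=> xd; apply: lt_le_trans xd _; rewrite ler_peMl ?ler1n // ltW.
have near_corner i j : i = (cell q1).1 \/ i = (cell q2).1 ->
    j = (cell q1).2 \/ j = (cell q2).2 ->
    exists2 p', K p' & ball p' (2 * d) (grid_pt (i, j)).
  move=> hi hj; exists q1 => //; apply/ball_pairP; split.
    by case: hi => ->; [apply: lt1 | apply: lt2 qx _].
  by case: hj => ->; [apply: lt1 | apply: lt2 qy _].
apply: reach_trans IH _; apply: reach_corner => k hk; apply: near_corner.
- exact: between_step lx lx' hk.
- by left.
- by right.
exact: between_step ly ly' hk.
Qed.

(** Balls of the product norm are squares, so they contain an L-shaped path between any two of their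
    grid points. *)
Lemma ball_reach p (r : R) c : d <= r -> - M <= p.1 -> - M <= p.2 ->
  ball p r (grid_pt c) -> reach (fun c' => ball p r (grid_pt c')) (cell p) c.
Proof.
move=> dr p1 p2 /ball_pairP[c1 c2].
have /ball_pairP[n1 n2] := cell_near p1 p2.
have between (x : R) i j k : `|x - (i%:R * d - M)| < r -> `|x - (j%:R * d - M)| < r ->
    (minn i j <= k <= maxn i j)%N -> `|x - (k%:R * d - M)| < r.
  wlog leij : i j / (i <= j)%N.
    by move=> wl hi hj hk; case/orP: (leq_total i j) => le; [apply: (wl i j) | apply: (wl j i); rewrite // minnC maxnC].
  rewrite (minn_idPl leij) (maxn_idPr leij) !ltr_norml => hi hj /andP[ik kj].
  have : i%:R * d <= k%:R * d by rewrite ler_wpM2r ?ler_nat // ltW.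
  have : k%:R * d <= j%:R * d by rewrite ler_wpM2r ?ler_nat // ltW.
  lra.
have n1' := lt_le_trans n1 dr; have n2' := lt_le_trans n2 dr.
apply: reach_corner => k hk; apply/ball_pairP; split=> //=.
  exact: between hk.
exact: between hk.
Qed.

End Grid.

(** * Discretizing the drawing *)

Section PlanarGrid.
Local Open Scope classical_set_scope.
Local Open Scope ring_scope.
Variables (R : realType) (V : finType) (e : rel V).
Hypotheses (e_sym : symmetric e) (e_irr : irreflexive e).

(* The branch set of u is a box around u together with, for every edge uv     *)
(* oriented from u to v, a discretization of its arc up to the first visit to *)
(* the box of v.  Outside the boxes the arcs are too far from each other to   *)
(* share a grid point.                                                        *)
Lemma planar_grid_model : planar R e -> exists n beta, grid_model e n beta.
Proof.
case=> pos [arc drawing].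
have [r r0 [sepv sepa]] := vertices_separated drawing.
have r4 : 0 < r / 4 by rewrite divr_gt0.
have [h h0 seph] := arcs_separated drawing r4.
have [M M0 bnd] := drawing_bounded drawing.
(* Arcs with a common grid point within [2d] come within [h] of each other; if this happens within
   [r / 4] of a vertex, the grid point falls in the box of radius [r / 2]. *)
pose d := Num.min h (r / 4) / 4.
have d0 : 0 < d by rewrite divr_gt0 // lt_min h0 r4.
have d4h : 2 * d + 2 * d <= h.
  have : Num.min h (r / 4) <= h by rewrite ge_min lexx.
  rewrite /d; move: (Num.min h _) => y; lra.
have d4r : 2 * d + 2 * d <= r / 4.
  have : Num.min h (r / 4) <= r / 4 by rewrite ge_min lexx orbT.
  rewrite /d; move: (Num.min h _) => y; lra.
have d_r2 : d <= r / 2 by lra.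
have d_r : r / 2 + 2 * d <= r by lra.
have d_r' : r / 4 + 2 * d <= r / 2 by lra.
have r_half : r / 2 + r / 2 <= r by lra.
have r2r : r / 2 <= r by lra.
have d2r : 2 * d <= r by lra.
move: d d0 d4h d_r2 d_r d_r' d2r {d4r} => d d0 d4h d_r2 d_r d_r' d2r.
pose g := grid_pt M d; pose cl := cell M d.
pose box u c := ball (pos u) (r / 2) (g c).
pose K u v := arc [set u; v]%SET.
pose near u v c := exists2 p, K u v p & ball p (2 * d) (g c).
(* Each edge is discretized once, from its end of smaller rank. *)
pose o u v := e u v && (enum_rank u < enum_rank v)%N.
have posM u : - M <= (pos u).1 /\ - M <= (pos u).2.
  have [|] := bnd (pos u); first by left; exists u.
  by rewrite !ler_norml => /andP[-> _] /andP[-> _].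
have KM u v : e u v -> forall q, K u v q -> - M <= q.1 /\ - M <= q.2.
  move=> euv q Kq; have [|] := bnd q; first by right; exists u, v.
  by rewrite !ler_norml => /andP[-> _] /andP[-> _].
have box_cell u : box u (cl (pos u)).
  have [x y] := posM u; exact: le_ball d_r2 _ (cell_near d0 x y).
have box_disj u w c : box u c -> box w c -> u = w.
  move=> uc wc; have [//|/eqP uw] := eqVneq u w; exfalso; apply: (sepv u w uw).
  exact: le_ball r_half _ (ball_triangle uc (ball_sym wc)).
have near_box u v w c : e u v -> near u v c -> box w c -> w <> u -> w <> v -> False.
  move=> euv [p Kp pc] wc wu wv; apply: (sepa u v w p euv wu wv Kp).
  exact: le_ball d_r _ (ball_triangle wc (ball_sym pc)).
(* A walk along the arc that stops just before the box of [v], and the first grid point in that box;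
   other pairs get a dummy value. *)
have /fin_all_exists[W WP] (uv : V * V) : exists sx : seq (nat * nat) * (nat * nat),
    o uv.1 uv.2 -> [/\ path grid_adj (cl (pos uv.1)) sx.1,
      forall c, c \in cl (pos uv.1) :: sx.1 -> near uv.1 uv.2 c /\ ~ box uv.2 c,
      box uv.2 sx.2 & grid_adj (last (cl (pos uv.1)) sx.1) sx.2].
  case: uv => u v /=; have [/andP[euv _]|] := boolP (o u v); last by exists ([::], (0%N, 0%N)).
  have uv : u <> v by move=> uv; rewrite uv e_irr in euv.
  have ch : eps_chain (K u v) d (pos u) (pos v).
    apply: connected_eps_chain => //; first exact: (arc_connected drawing).
      exact: (arc_start drawing).
    exact: (arc_end drawing).
  have [s [us sv sP]] := eps_chain_reach d0 (KM u v euv) ch.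
  have ubox : ~ box v (cl (pos u)) by move=> /(box_disj _ _ _ (box_cell u)).
  have hs : has (fun c => `[< box v c >]) s.
    apply/hasP; exists (cl (pos v)); last by apply/asboolP.
    have : cl (pos v) \in cl (pos u) :: s by rewrite /cl -sv mem_last.
    rewrite inE => /predU1P[E|//]; case: ubox; rewrite -E; exact: box_cell.
  case: (split_find hs) us sv sP => x s1 s2 /asboolP vx noP + _ sP.
  rewrite cat_path rcons_path => /andP[/andP[us1 lx] _].
  exists (s1, x); split=> // c cs1; split.
    apply: sP; move: cs1; rewrite !inE mem_cat mem_rcons inE => /orP[->//|->].
    by rewrite !orbT.
  move: cs1; rewrite inE => /predU1P[->//|cs1] vc.
  by case/hasP: noP; exists c => //; apply/asboolP.
pose B u c := box u c \/ exists v, o u v /\ c \in cl (pos u) :: (W (u, v)).1.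
have walk_box u v c w : o u v -> c \in cl (pos u) :: (W (u, v)).1 -> box w c -> w = u.
  move=> ouv cW wc; have [_ /(_ c cW)[nc vc] _ _] := WP (u, v) ouv.
  have [//|/eqP wu] := eqVneq w u; exfalso; apply: (near_box u v w c) => //.
    by case/andP: ouv.
  by move=> wv; apply: vc; rewrite /= -wv.
have B_disj u w c : B u c -> B w c -> u = w.
  move=> [uc|[v [ouv cv]]] [wc|[y [owy cy]]].
  - exact: box_disj uc wc.
  - exact: walk_box owy cy uc.
  - by apply/esym; apply: walk_box ouv cv wc.
  (* Walks from different vertices belong to different edges, so a shared grid point lies in the box
     of some vertex [x]; but a walk meets no box except that of its start. *)
  have [//|/eqP uw] := eqVneq u w.
  have [_ /(_ c cv)[[p Kp pc] _] _ _] := WP (u, v) ouv.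
  have [_ /(_ c cy)[[q Kq qc] _] _ _] := WP (w, y) owy.
  have /andP[euv luv] := ouv; have /andP[ewy lwy] := owy.
  have uvwy : [set u; v]%SET <> [set w; y]%SET.
    move=> E; have : u \in [set w; y]%SET by rewrite -E !inE eqxx.
    rewrite !inE => /orP[/eqP//|/eqP uy].
    have : w \in [set u; v]%SET by rewrite E !inE eqxx.
    rewrite !inE => /orP[/eqP wu|/eqP wv]; first by case: uw.
    by move: luv lwy; rewrite uy wv; case: ltngtP.
  have pq : ball p h q := le_ball d4h (ball_triangle pc (ball_sym qc)).
  have [x xp] := seph u v w y p q euv ewy uvwy Kp Kq pq.
  have xc : box x c := le_ball d_r' (ball_triangle xp pc).
  by rewrite -(walk_box _ _ _ _ ouv cv xc) -(walk_box _ _ _ _ owy cy xc).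
pose beta c := [pick u | `[< B u c >]].
have betaP u c : B u c <-> beta c = Some u.
  rewrite /beta; case: pickP => [w /asboolP wc|no]; split=> //.
  - by move=> uc; rewrite (B_disj _ _ _ uc wc).
  - by case=> <-.
  by move=> /asboolP; rewrite no.
have B_near u c : B u c -> exists p, (`|p.1| <= M /\ `|p.2| <= M) /\ ball p r (g c).
  case=> [uc|[v [ouv cv]]].
    exists (pos u); split; first by apply: bnd; left; exists u.
    exact: le_ball r2r _ uc.
  have [_ /(_ c cv)[[p Kp pc] _] _ _] := WP (u, v) ouv.
  exists p; split; last exact: le_ball d2r _ pc.
  by apply: bnd; right; exists u, v; case/andP: ouv.
exists (Num.truncn ((M + M + r) / d)).+1, beta; split.
- move=> c; case bc : (beta c) => [u|//] _; have /B_near[p [[p1 p2] /ball_pairP[]]] := (betaP u c).2 bc.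
  have lt (x : R) i : `|x| <= M -> `|x - (i%:R * d - M)| < r -> (i < (Num.truncn ((M + M + r) / d)).+1)%N.
    rewrite ler_norml ltr_norml => /andP[_ xM] /andP[xi _].
    have y0 : 0 <= (M + M + r) / d by apply: divr_ge0; [lra | exact: ltW].
    by rewrite ltnS truncn_ge_nat // ler_pdivlMr //; move: (_ * d) xi => z; lra.
  by move=> c1 c2; split; [apply: lt p1 c1 | apply: lt p2 c2].
- move=> u; exists (cl (pos u)) => c /betaP[uc|[v [ouv cv]]].
    have [x y] := posM u; have [s [us sc sP]] := ball_reach d0 d_r2 x y uc.
    by exists s; split=> // c' /sP c's; apply/betaP; left.
  have [us sP _ _] := WP (u, v) ouv; rewrite /= in us.
  move: cv; rewrite inE => /predU1P[->|cv].
    exists [::]; split=> // c'; rewrite inE => /eqP->; apply/betaP; left; exact: box_cell.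
  have inW c' : c' \in cl (pos u) :: (W (u, v)).1 -> beta c' = Some u.
    by move=> c's; apply/betaP; right; exists v.
  case/splitPr: cv us inW => s1 s2; rewrite -cat_rcons cat_path => /andP[us _] inW.
  exists (rcons s1 c); split=> //; first by rewrite last_rcons.
  by move=> c' c's; apply: inW; rewrite -cat_cons mem_cat c's.
have cross u v : o u v -> exists p q, [/\ grid_adj p q, beta p = Some u & beta q = Some v].
  move=> ouv; have [us sP vx lx] := WP (u, v) ouv.
  exists (last (cl (pos u)) (W (u, v)).1), (W (u, v)).2; split=> //.
    by apply/betaP; right; exists v; split=> //; apply: mem_last.
  by apply/betaP; left.
move=> u v euv; case: (ltngtP (enum_rank u) (enum_rank v)) => [lt|lt|/ord_inj/enum_rank_inj uv].
- by apply: cross; rewrite /o euv.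
- have [|p [q [pq pv qu]]] := cross v u; first by rewrite /o e_sym euv.
  exists q, p; split=> //; move: pq; rewrite /grid_adj.
  by rewrite (eq_sym q.1) (eq_sym q.2) [(q.2.+1 == _) || _]orbC [(q.1.+1 == _) || _]orbC.
by rewrite uv e_irr in euv.
Qed.

End PlanarGrid.

(** * The sparse cycle, the colouring and the bound *)

Section Planar.
Local Open Scope nat_scope.
Variables (R : realType) (V : finType) (e : rel V).
Hypotheses (e_sym : symmetric e) (e_irr : irreflexive e).

Lemma planar_sparse_cycle (S : {set V}) : planar R e -> S != finset.set0 ->
  (forall v, v \in S -> 2 <= #|nbrs e S v|) ->
  exists c, [/\ 3 <= size c, {subset c <= S}, uniq c, cycle e c
    & count (branch e S) c <= 5].
Proof.
move=> /(planar_grid_model e_sym e_irr)[n [beta model]] /finset.set0Pn[v0 v0S] d2.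
have [Q [b basis]] := grid_two_basis e_irr S model.
have degE v : v \in S ->
    edge_degree (@edge_src _ e S) (@edge_tgt _ e S) (fun=> true) v = #|nbrs e S v|.
  by move=> vS; rewrite (edge_degree_nbrs e_sym e_irr).
have [v vS|s [s_even s0 s12]] := exists_light_cycle v0S (@edge_srcS _ e S) (@edge_tgtS _ e S) basis.
  by rewrite degE // d2.
apply: (light_graph_cycle e_sym e_irr s_even s0); apply: leq_ltn_trans s12.
by rewrite leq_eqVlt; apply/orP; left; apply/eqP/eq_bigl => v;
  case: (boolP (v \in S)) => //= vS; rewrite degE.
Qed.

Lemma planar_dominating_colouring k : 2 <= k -> planar R e ->
  (forall v, 2 <= degree e v) -> girth_at_least e (15 * k - 14) ->
  exists phi : V -> {set 'I_(3 * k - 1)}, dominating_colouring e k phi.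
Proof.
move=> k2 e_planar d2 girth.
have cardC : #|'I_(3 * k - 1)| = 3 * k - 1 by rewrite card_ord.
have [S S0 dS|phi wphi] := exists_well_coloured e_sym e_irr cardC k2.
  have [c [c3 cS uc ec c5]] := planar_sparse_cycle e_planar S0 dS.
  by exists c; split=> //; apply: girth.
exists phi; split=> [|v]; first exact: wphi.1.
have : seen e phi [set: V]%SET v = [set: _]%SET.
  apply: (well_coloured_full cardC wphi); first by rewrite finset.in_setT.
  by apply: leq_trans (d2 v) _; apply: subset_leq_card; apply/fintype.subsetP=> u;
    rewrite !inE.
by move=> <-; apply: eq_bigl => u; rewrite !inE.
Qed.

End Planar.

Section Fdom.
Local Open Scope classical_set_scope.
Local Open Scope ring_scope.
Variables (R : realType) (V : finType) (e : rel V).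

Lemma colouring_ratio_le_fdom p q (phi : V -> {set 'I_p}) : (0 < #|V|)%N ->
  (0 < q <= p)%N -> dominating_colouring e q phi -> p%:R / q%:R <= fdom R e.
Proof.
move=> /card_gt0P[v _] qp dom; apply: ub_le_sup; last first.
  by exists p, q; split=> //; exists phi.
(* All [p'] colours occur in one closed neighbourhood, on at most [|V|] sets of [q'] colours each;
   this bounds the ratios, as [ub_le_sup] requires. *)
exists #|V|%:R => _ [p' [q' [/andP[q0 _] [psi [psiq cover]] ->]]].
rewrite ler_pdivrMr ?ltr0n // -natrM ler_nat.
have -> : p' = #|\bigcup_(u in closed_neighbourhood e v) psi u|%SET by rewrite cover finset.cardsT card_ord.
apply: (@leq_trans (\sum_(u in closed_neighbourhood e v) #|psi u|)%N).
  elim/big_rec2: _ => [|u m A _ le]; first by rewrite finset.cards0.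
  by apply: leq_trans (leq_add (leqnn _) le); rewrite finset.cardsU leq_subr.
under eq_bigr do rewrite psiq.
by rewrite sum_nat_const leq_mul2r max_card orbT.
Qed.

End Fdom.

Local Open Scope ring_scope.

Theorem theorem23 (R : realType) (k : nat) (V : finType) (e : rel V)
  (hk : (2 <= k)%N)
  (hV : (0 < #|V|)%N)
  (e_sym : symmetric e) (e_irr : irreflexive e)
  (e_planar : planar R e)
  (e_mindeg : forall v : V, (2 <= degree e v)%N)
  (e_girth : girth_at_least e (15 * k - 14)) :
  3 - k%:R^-1 <= fdom R e.
Proof.
have lt0k : (0 < k)%N by apply: ltnW.
have [phi dom] := planar_dominating_colouring e_sym e_irr hk e_planar e_mindeg e_girth.
have k0 : k%:R != 0 :> R by rewrite pnatr_eq0 -lt0n.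
have -> : 3 - k%:R^-1 = (3 * k - 1)%:R / k%:R :> R.
  by rewrite natrB ?natrM ?mulrBl ?mulfK ?div1r // muln_gt0 lt0k.
by apply: colouring_ratio_le_fdom dom; rewrite // lt0k leq_subRL ?muln_gt0 //; lia.
Qed.
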